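(* Let $\Bbbk$ be an algebraically closed field, let $G$ be an affine algebraic group over $\Bbbk$, and let $R$ be an associative $\Bbbk$-algebra with $1$ on which $G$ acts rationally by $\Bbbk$-algebra automorphisms. If $P\in\operatorname{Rat}R$ is locally closed in $\operatorname{Spec}R$, then the $G$-orbit $G.P=\{g.P\mid g\in G\}$ is open in its closure in $\operatorname{Rat}R$.
   Context: The action of $G$ on $R$ is rational if $R$ is a union of finite-dimensional $G$-stable subspaces $V$ on each of which $G$ acts via a homomorphism of algebraic groups $G\to \operatorname{GL}(V)$. Extended centroid: for a ring $U$, let $\mathcal E$ be the filter of all two-sided ideals $I$ of $U$ with zero left annihilator $\{u\in U\mid uI=0\}$; the (right) Amitsur-Martindale ring of quotients of $U$ is $\varinjlim_{I\in\mathcal E}\operatorname{Hom}(I_U,U_U)$, and the extended centroid $\mathcal C(U)$ is its center. If $U$ is prime, $\mathcal C(U)$ is a field. $\operatorname{Spec} R$ is the set of prime ideals of $R$ with the Jacobson-Zariski topology: the closed sets are $\mathbf V(I)=\{P\in\operatorname{Spec}R\mid P\supseteq I\}$ for $I\subseteq R$. A prime $P$ of $R$ is rational if $\mathcal C(R/P)=\Bbbk$. $\operatorname{Rat}R\subseteq\operatorname{Spec}R$ is the set of rational ideals with the topology induced from $\operatorname{Spec}R$; it is stable under the $G$-action on $\operatorname{Spec} R$. A point $x$ of a topological space $X$ is locally closed if $\{x\}$ is open in its closure in $X$. *)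

(* Defs.v *)
From HB Require Import structures.
From mathcomp Require Import all_boot all_order all_algebra mpoly.
From mathcomp Require Import boolp classical_sets.
From mathcomp Require Import topology_structure subtype_topology.

Set Implicit Arguments.
Unset Strict Implicit.
Unset Printing Implicit Defensive.

Import GRing.Theory.
Local Open Scope classical_set_scope.
Local Open Scope ring_scope.

(* Since k is algebraically closed, an affine variety is identified with its
   set of k-points; it is not required to be irreducible. *)

Section AffineVarieties.
Variable k : closedFieldType.

Definition zero_locus n (S : set {mpoly k[n]}) : set 'rV[k]_n :=
  [set v | forall p, S p -> p.@[v ord0] = 0].

(* The structure of an affine variety on a set X is presented by a bijection
   from X to a Zariski-closed subset of an affine space. *)
Record affineStructure (X : Type) := AffineStructure {
  aff_dim : nat;
  aff_coord : X -> 'rV[k]_aff_dim;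
  aff_coord_inj : injective aff_coord;
  aff_closed : exists S, range aff_coord = zero_locus S }.

Definition eval_mx n m1 m2 (v : 'rV[k]_n) (Q : 'M[{mpoly k[n]}]_(m1, m2)) :
  'M[k]_(m1, m2) := map_mx (meval (v ord0)) Q.

Definition is_morphism X Y (sX : affineStructure X) (sY : affineStructure Y)
    (f : X -> Y) :=
  exists Q : 'rV[{mpoly k[aff_dim sX]}]_(aff_dim sY),
    forall x, aff_coord sY (f x) = eval_mx (aff_coord sX x) Q.

Section Product.
Variables (X Y : Type) (sX : affineStructure X) (sY : affineStructure Y).
Let n := aff_dim sX.
Let m := aff_dim sY.

Definition prod_coord (z : X * Y) : 'rV[k]_(n + m) :=
  row_mx (aff_coord sX z.1) (aff_coord sY z.2).

Fact prod_coord_inj : injective prod_coord.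
Proof.
move=> [x y] [x' y'] /= /eq_row_mx[] /= ex ey.
by rewrite (aff_coord_inj ex) (aff_coord_inj ey).
Qed.

Fact prod_closed : exists S, range prod_coord = zero_locus S.
Proof.
have [S1 e1] := aff_closed sX; have [S2 e2] := aff_closed sY.
pose l1 : n.-tuple {mpoly k[n + m]} := [tuple 'X_(lshift m i) | i < n].
pose l2 : m.-tuple {mpoly k[n + m]} := [tuple 'X_(rshift n i) | i < m].
have ev1 (v : 'rV[k]_(n + m)) p : (p \mPo l1).@[v ord0] = p.@[lsubmx v ord0].
  by rewrite comp_mpoly_meval; apply: meval_eq => i; rewrite tnth_mktuple mevalXU mxE.
have ev2 (v : 'rV[k]_(n + m)) p : (p \mPo l2).@[v ord0] = p.@[rsubmx v ord0].
  by rewrite comp_mpoly_meval; apply: meval_eq => i; rewrite tnth_mktuple mevalXU mxE.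
exists ([set p \mPo l1 | p in S1] `|` [set p \mPo l2 | p in S2]).
apply/seteqP; split=> [_ [[x y] _ <-]|v /= vS].
  have x1 : zero_locus S1 (aff_coord sX x) by rewrite -e1; exists x.
  have y2 : zero_locus S2 (aff_coord sY y) by rewrite -e2; exists y.
  move=> _ [[p Sp <-]|[p Sp <-]].
    by rewrite ev1 row_mxKl; apply: x1.
  by rewrite ev2 row_mxKr; apply: y2.
have : zero_locus S1 (lsubmx v).
  by move=> p Sp; rewrite -ev1; apply: vS; left; exists p.
rewrite -e1 => -[x _ ex].
have : zero_locus S2 (rsubmx v).
  by move=> p Sp; rewrite -ev2; apply: vS; right; exists p.
rewrite -e2 => -[y _ ey].
by exists (x, y) => //; rewrite /prod_coord /= ex ey hsubmxK.
Qed.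

Definition prod_affine := AffineStructure prod_coord_inj prod_closed.
End Product.

End AffineVarieties.

Record affineAlgGroup (k : closedFieldType) := AffineAlgGroup {
  aag_group :> groupType;
  aag_affine : affineStructure k aag_group;
  aag_mul : is_morphism (prod_affine aag_affine aag_affine) aag_affine
              (fun z => z.1 * z.2)%g;
  aag_inv : is_morphism aag_affine aag_affine (fun x => x^-1)%g }.

Definition algGroup_hom (k : closedFieldType) (G H : affineAlgGroup k) (f : G -> H) :=
  (forall x y : G, f (x * y)%g = (f x * f y)%g) /\
  is_morphism (aag_affine G) (aag_affine H) f.

Section GL.
Variables (k : closedFieldType) (n : nat).

Definition gl := {A : 'M[k]_n | A \in unitmx}.
HB.instance Definition _ := Choice.on gl.

Definition gl_one : gl := exist _ 1%:M (unitmx1 k n).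

Fact gl_mul_subproof (A B : gl) : val A *m val B \in unitmx.
Proof. by rewrite unitmx_mul (valP A) (valP B). Qed.
Definition gl_mul (A B : gl) : gl :=
  exist _ (val A *m val B) (gl_mul_subproof A B).

Fact gl_inv_subproof (A : gl) : invmx (val A) \in unitmx.
Proof. by rewrite unitmx_inv (valP A). Qed.
Definition gl_inv (A : gl) : gl := exist _ (invmx (val A)) (gl_inv_subproof A).

Fact gl_mulA : associative gl_mul.
Proof. by move=> A B C; apply: val_inj; rewrite /= mulmxA. Qed.
Fact gl_mul1 : left_id gl_one gl_mul.
Proof. by move=> A; apply: val_inj; rewrite /= mul1mx. Qed.
Fact gl_mulr1 : right_id gl_one gl_mul.
Proof. by move=> A; apply: val_inj; rewrite /= mulmx1. Qed.
Fact gl_mulV : left_inverse gl_one gl_inv gl_mul.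
Proof. by move=> A; apply: val_inj; rewrite /= mulVmx // (valP A). Qed.
Fact gl_mulrV : right_inverse gl_one gl_inv gl_mul.
Proof. by move=> A; apply: val_inj; rewrite /= mulmxV // (valP A). Qed.
HB.instance Definition _ :=
  isGroup.Build gl gl_mulA gl_mul1 gl_mulr1 gl_mulV gl_mulrV.

(* GL_n is the closed subset det A * d = 1 of the affine space of pairs
   (A, d). *)
Definition gl_coord (A : gl) : 'rV[k]_(n * n + 1) :=
  row_mx (mxvec (val A)) ((\det (val A))^-1)%:M.

Fact gl_coord_inj : injective gl_coord.
Proof.
by move=> A B /eq_row_mx[] /(can_inj mxvecK) eAB _; apply: val_inj.
Qed.

Section Generic.
Variables (m : nat) (f : 'I_(n * n + 1) -> 'I_m).

Definition gl_Xmx : 'M[{mpoly k[m]}]_n :=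
  vec_mx (\row_j 'X_(f (lshift 1 j))).
Definition gl_Xdetinv : {mpoly k[m]} := 'X_(f (rshift (n * n) ord0)).

Lemma eval_gl_Xmx (v : 'rV[k]_m) (w : 'rV[k]_(n * n + 1)) :
    (forall i, v ord0 (f i) = w ord0 i) ->
  eval_mx v gl_Xmx = vec_mx (lsubmx w).
Proof.
by move=> vw; apply/matrixP => i j; rewrite !mxE mevalXU vw.
Qed.

Lemma eval_gl_Xdetinv (v : 'rV[k]_m) (w : 'rV[k]_(n * n + 1)) :
    (forall i, v ord0 (f i) = w ord0 i) ->
  gl_Xdetinv.@[v ord0] = rsubmx w ord0 ord0.
Proof. by move=> vw; rewrite /gl_Xdetinv mevalXU vw mxE. Qed.
End Generic.

Fact gl_closed : exists S, range gl_coord = zero_locus S.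
Proof.
exists [set \det (gl_Xmx id) * gl_Xdetinv id - 1].
apply/seteqP; split=> [_ [A _ <-] _ ->|v /= /(_ _ erefl)].
  rewrite mevalB mevalM meval1 -det_map_mx /= -/(eval_mx _ _).
  rewrite (eval_gl_Xmx (w := gl_coord A)) // (eval_gl_Xdetinv (w := gl_coord A)) //.
  rewrite row_mxKl row_mxKr mxvecK !mxE eqxx mulr1n mulrV ?subrr //.
  by rewrite -unitmxE (valP A).
rewrite mevalB mevalM meval1 -det_map_mx /= -/(eval_mx _ _).
rewrite (eval_gl_Xmx (w := v)) // (eval_gl_Xdetinv (w := v)) //.
move=> /subr0_eq e.
have uA : vec_mx (lsubmx v) \in unitmx.
  by rewrite unitmxE unitfE; apply: contra_eq_neq e => ->; rewrite mul0r eq_sym oner_neq0.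
exists (exist _ (vec_mx (lsubmx v)) uA) => //.
rewrite /gl_coord /= vec_mxK; rewrite -[RHS]hsubmxK; congr row_mx.
apply/matrixP => i j; rewrite !ord1 [in LHS]mxE eqxx mulr1n.
by rewrite -[LHS]mulr1 -e mulKr // -unitmxE.
Qed.

Definition gl_affine := AffineStructure gl_coord_inj gl_closed.

Lemma eval_mx_row (m m1 m2 : nat) (v : 'rV[k]_m)
    (A : 'rV[{mpoly k[m]}]_m1) (B : 'rV[{mpoly k[m]}]_m2) :
  eval_mx v (row_mx A B) = row_mx (eval_mx v A) (eval_mx v B).
Proof. exact: map_row_mx. Qed.

Fact gl_mul_morphism : is_morphism (prod_affine gl_affine gl_affine) gl_affine
  (fun z => z.1 * z.2)%g.
Proof.
pose N := (n * n + 1)%N.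
pose fl : 'I_N -> 'I_(N + N) := @lshift N N.
pose fr : 'I_N -> 'I_(N + N) := @rshift N N.
exists (row_mx (mxvec (gl_Xmx fl *m gl_Xmx fr))
               (gl_Xdetinv fl * gl_Xdetinv fr)%:M).
move=> [A B]; set v := aff_coord _ (A, B).
have vl i : v ord0 (fl i) = gl_coord A ord0 i by rewrite /v /= row_mxEl.
have vr i : v ord0 (fr i) = gl_coord B ord0 i by rewrite /v /= row_mxEr.
rewrite [RHS]eval_mx_row /= /gl_coord /=; congr row_mx.
  rewrite /eval_mx map_mxvec map_mxM -!/(eval_mx _ _).
  by rewrite (eval_gl_Xmx vl) (eval_gl_Xmx vr) !row_mxKl !mxvecK.
rewrite /eval_mx map_scalar_mx /= mevalM (eval_gl_Xdetinv vl) (eval_gl_Xdetinv vr).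
by rewrite !row_mxKr ![in RHS]mxE eqxx !mulr1n det_mulmx invfM.
Qed.

Fact gl_inv_morphism :
  is_morphism gl_affine gl_affine (fun x => x^-1)%g.
Proof.
exists (row_mx (mxvec (gl_Xdetinv id *: \adj (gl_Xmx id))) (\det (gl_Xmx id))%:M).
move=> A; set v := aff_coord _ A.
have vE i : v ord0 (id i) = gl_coord A ord0 i by [].
rewrite [RHS]eval_mx_row /= /gl_coord /=; congr row_mx.
  rewrite /eval_mx map_mxvec map_mxZ map_mx_adj -!/(eval_mx _ _).
  rewrite (eval_gl_Xmx vE) /= (eval_gl_Xdetinv vE) row_mxKl row_mxKr mxvecK.
  by rewrite mxE eqxx mulr1n /invmx (valP A).
rewrite /eval_mx map_scalar_mx /= -det_map_mx -/(eval_mx _ _) (eval_gl_Xmx vE).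
by rewrite row_mxKl mxvecK det_inv invrK.
Qed.

Definition GL := AffineAlgGroup gl_mul_morphism gl_inv_morphism.
End GL.

Section Ideals.
Variable U : nzRingType.

Record two_sided_ideal (I : set U) : Prop := TwoSidedIdeal {
  ideal0 : I 0;
  idealB : forall x y, I x -> I y -> I (x - y);
  idealMl : forall a x, I x -> I (a * x);
  idealMr : forall a x, I x -> I (x * a) }.

Lemma idealN I x : two_sided_ideal I -> I x -> I (- x).
Proof. by move=> iI Ix; rewrite -sub0r; apply: (idealB iI) => //; apply: ideal0. Qed.

Lemma idealD I x y : two_sided_ideal I -> I x -> I y -> I (x + y).
Proof. by move=> iI Ix Iy; rewrite -[y]opprK; apply: (idealB iI) => //; apply: idealN. Qed.

Lemma idealT : two_sided_ideal setT. Proof. by []. Qed.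

Lemma idealI I J :
  two_sided_ideal I -> two_sided_ideal J -> two_sided_ideal (I `&` J).
Proof.
move=> iI iJ; split=> [|x y [Ix Jx] [Iy Jy]|a x [Ix Jx]|a x [Ix Jx]]; split.
- exact: ideal0.
- exact: ideal0.
- exact: idealB.
- exact: idealB.
- exact: idealMl.
- exact: idealMl.
- exact: idealMr.
- exact: idealMr.
Qed.

Definition ideal_gen (A : set U) : set U :=
  [set x | forall I, two_sided_ideal I -> A `<=` I -> I x].

Lemma ideal_gen_ideal A : two_sided_ideal (ideal_gen A).
Proof.
split=> [I iI _|x y gx gy I iI AI|a x gx I iI AI|a x gx I iI AI].
- exact: ideal0.
- by apply: idealB => //; [apply: gx|apply: gy].
- by apply: idealMl => //; apply: gx.
- by apply: idealMr => //; apply: gx.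
Qed.

Lemma sub_ideal_gen A : A `<=` ideal_gen A.
Proof. by move=> x Ax I _; apply. Qed.

Lemma ideal_gen_sub A I : two_sided_ideal I -> A `<=` I -> ideal_gen A `<=` I.
Proof. by move=> iI AI x; apply. Qed.

Definition left_annihilator (I : set U) : set U :=
  [set u | forall x, I x -> u * x = 0].

Definition AMfilter (I : set U) :=
  two_sided_ideal I /\ left_annihilator I = [set 0].

Lemma AMfilterP I :
  two_sided_ideal I -> left_annihilator I `<=` [set 0] -> AMfilter I.
Proof.
by move=> iI aI; split=> //; apply/seteqP; split=> // _ -> x _; rewrite mul0r.
Qed.

Lemma AMfilter_ann I u : AMfilter I -> (forall x, I x -> u * x = 0) -> u = 0.
Proof. by case=> _ aI uI; have : left_annihilator I u by []; rewrite aI. Qed.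

Lemma AMfilterT : AMfilter setT.
Proof. by apply: AMfilterP => // u /(_ 1 I); rewrite mulr1. Qed.

Lemma AMfilterI I J : AMfilter I -> AMfilter J -> AMfilter (I `&` J).
Proof.
move=> fI fJ; apply: AMfilterP; first by apply: idealI; [case: fI|case: fJ].
move=> u uIJ; apply: (AMfilter_ann fI) => x Ix; apply: (AMfilter_ann fJ) => y Jy.
rewrite -mulrA; apply: uIJ; split; first exact: idealMr fI.1 _ _ Ix.
exact: idealMl fJ.1 _ _ Jy.
Qed.

Definition ideal_prod (J I : set U) : set U :=
  ideal_gen [set z | exists x y, [/\ J x, I y & z = x * y]].

Lemma AMfilterM I J : AMfilter I -> AMfilter J -> AMfilter (ideal_prod J I).
Proof.
move=> fI fJ; apply: AMfilterP; first exact: ideal_gen_ideal.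
move=> u uIJ; apply: (AMfilter_ann fJ) => x Jx; apply: (AMfilter_ann fI) => y Iy.
by rewrite -mulrA; apply: uIJ; apply: sub_ideal_gen; exists x, y.
Qed.
End Ideals.

Section AmitsurMartindale.
Variable U : nzRingType.

Let ideal_prod_sub (J I : set U) (g : U -> U) :
    two_sided_ideal J -> two_sided_ideal I ->
    (forall x y, J x -> J y -> g (x - y) = g x - g y) ->
    (forall x a, J x -> g (x * a) = g x * a) ->
  forall x, ideal_prod J I x -> J x /\ I (g x).
Proof.
move=> iJ iI gB gM x Px.
suff /(_ 1) : forall a, J (a * x) /\ I (g (a * x)) by rewrite mul1r.
apply: (Px [set x | forall a, J (a * x) /\ I (g (a * x))]); last first.
  move=> _ [y [z [Jy Iz ->]]] a; rewrite mulrA.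
  have Jay := idealMl iJ a Jy.
  by split; [apply: idealMr | rewrite gM //; apply: idealMl].
split=> [a|{x Px} x y Px Py a|{x Px} b x Px a|{x Px} b x Px a].
- rewrite mulr0; split; first exact: ideal0.
  by rewrite -[0]subr0 gB ?subrr; [apply: ideal0|apply: ideal0|apply: ideal0].
- have [Jx Ix] := Px a; have [Jy Iy] := Py a.
  by rewrite mulrBr gB //; split; apply: idealB.
- by rewrite mulrA; apply: Px.
- have [Jx Ix] := Px a.
  by rewrite mulrA gM //; split; apply: idealMr.
Qed.

(* A homomorphism of right U-modules from an ideal in the filter to U. It is
   represented by a function on all of U, whose values outside the ideal are
   irrelevant and are forgotten by am_equiv. *)
Record amHom := AMHom {
  am_dom : set U;
  am_fun :> U -> U;
  am_domP : AMfilter am_dom;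
  am_funD : forall x y, am_dom x -> am_dom y -> am_fun (x + y) = am_fun x + am_fun y;
  am_funM : forall x a, am_dom x -> am_fun (x * a) = am_fun x * a }.

HB.instance Definition _ := gen_eqMixin amHom.
HB.instance Definition _ := gen_choiceMixin amHom.

Implicit Types f g h : amHom.

Lemma am_ideal f : two_sided_ideal (am_dom f).
Proof. exact: (am_domP f).1. Qed.

Lemma am_funB f x y : am_dom f x -> am_dom f y -> f (x - y) = f x - f y.
Proof.
move=> fx fy; rewrite am_funD //; last exact: idealN (am_ideal f) _.
by rewrite -mulrN1 am_funM // mulrN1.
Qed.

(* Equality in the direct limit: agreement on a smaller ideal of the filter. *)
Definition am_equiv : rel amHom := fun f g =>
  `[< exists J, [/\ AMfilter J, J `<=` am_dom f, J `<=` am_dom g &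
                    forall x, J x -> f x = g x] >].

Lemma am_equivW f g :
  (forall x, am_dom f x -> am_dom g x -> f x = g x) -> am_equiv f g.
Proof.
move=> fg; apply/asboolP; exists (am_dom f `&` am_dom g).
split; first by apply: AMfilterI; exact: am_domP.
- by move=> x [].
- by move=> x [].
- by move=> x []; apply: fg.
Qed.

Fact am_equiv_refl : reflexive am_equiv.
Proof. by move=> f; apply: am_equivW. Qed.

Fact am_equiv_sym : ssrbool.symmetric am_equiv.
Proof.
by move=> f g; apply/asboolP/asboolP=> -[J [fJ Jf Jg e]]; exists J; split=> // x /e.
Qed.

Fact am_equiv_trans : transitive am_equiv.
Proof.
move=> g f h /asboolP[J [fJ Jf Jg e]] /asboolP[K [fK Kg Kh e']].
apply/asboolP; exists (J `&` K); split; first exact: AMfilterI.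
- by move=> x [/Jf].
- by move=> x [_ /Kh].
- by move=> x [Jx Kx]; rewrite e ?e'.
Qed.

Canonical am_equiv_rel :=
  EquivRel am_equiv am_equiv_refl am_equiv_sym am_equiv_trans.

(* The direct limit of the groups Hom(I_U, U_U) over AMfilter. *)
Definition amQuot := {eq_quot am_equiv}%qT.
HB.instance Definition _ := Choice.on amQuot.
HB.instance Definition _ := EqQuotient.on amQuot.
Local Notation pi := (\pi_amQuot)%qT.

Lemma pi_eq f g : reflect (pi f = pi g) (am_equiv f g).
Proof. exact: eqmodP. Qed.

Lemma repr_equiv f : am_equiv (repr (pi f)) f.
Proof. by apply/pi_eq; rewrite reprK. Qed.

Definition am_lmul (u : U) : amHom :=
  @AMHom setT (fun x => u * x) (AMfilterT U) (fun x y _ _ => mulrDr u x y)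
    (fun x a _ => mulrA u x a).

Program Definition am_add f g : amHom :=
  @AMHom (am_dom f `&` am_dom g) (fun x => f x + g x) _ _ _.
Next Obligation. by move=> f g; apply: AMfilterI; apply: am_domP. Qed.
Next Obligation.
by move=> f g x y [fx gx] [fy gy] /=; rewrite !am_funD // addrACA.
Qed.
Next Obligation. by move=> f g x a [fx gx] /=; rewrite !am_funM // mulrDl. Qed.

Program Definition am_opp f : amHom :=
  @AMHom (am_dom f) (fun x => - f x) _ _ _.
Next Obligation. by move=> f; apply: am_domP. Qed.
Next Obligation. by move=> f x y fx fy /=; rewrite am_funD // opprD. Qed.
Next Obligation. by move=> f x a fx /=; rewrite am_funM // mulNr. Qed.

Lemma am_comp_dom f g x : ideal_prod (am_dom g) (am_dom f) x ->
  am_dom g x /\ am_dom f (g x).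
Proof.
by apply: ideal_prod_sub; [exact: am_ideal|exact: am_ideal|exact: am_funB|exact: am_funM].
Qed.

(* g maps the product ideal dom g * dom f to dom f. *)
Program Definition am_mul f g : amHom :=
  @AMHom (ideal_prod (am_dom g) (am_dom f)) (fun x => f (g x)) _ _ _.
Next Obligation. by move=> f g; apply: AMfilterM; apply: am_domP. Qed.
Next Obligation.
by move=> f g x y /am_comp_dom[gx fx] /am_comp_dom[gy fy] /=; rewrite !am_funD.
Qed.
Next Obligation. by move=> f g x a /am_comp_dom[gx fx] /=; rewrite !am_funM. Qed.

Definition amq_zero : amQuot := pi (am_lmul 0).
Definition amq_one : amQuot := pi (am_lmul 1).
Definition amq_add (p q : amQuot) : amQuot := pi (am_add (repr p) (repr q)).
Definition amq_opp (p : amQuot) : amQuot := pi (am_opp (repr p)).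
Definition amq_mul (p q : amQuot) : amQuot := pi (am_mul (repr p) (repr q)).

Lemma pi_add f g : amq_add (pi f) (pi g) = pi (am_add f g).
Proof.
apply/pi_eq; have /asboolP[J [fJ Jr Jf ef]] := repr_equiv f.
have /asboolP[K [fK Kr Kg eg]] := repr_equiv g.
apply/asboolP; exists (J `&` K); split; first exact: AMfilterI.
- by move=> x [/Jr ? /Kr].
- by move=> x [/Jf ? /Kg].
- by move=> x [Jx Kx]; rewrite /= ef ?eg.
Qed.

Lemma pi_opp f : amq_opp (pi f) = pi (am_opp f).
Proof.
apply/pi_eq; have /asboolP[J [fJ Jr Jf ef]] := repr_equiv f.
by apply/asboolP; exists J; split=> // x Jx; rewrite /= ef.
Qed.

Lemma pi_mul f g : amq_mul (pi f) (pi g) = pi (am_mul f g).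
Proof.
apply/pi_eq; have /asboolP[J [fJ Jr Jf ef]] := repr_equiv f.
have /asboolP[K [fK Kr Kg eg]] := repr_equiv g.
apply/asboolP; exists (ideal_prod K J); split; first exact: AMfilterM.
- apply: ideal_gen_sub; first exact: ideal_gen_ideal.
  by move=> _ [x [y [Kx Jy ->]]]; apply: sub_ideal_gen; exists x, y; split; auto.
- apply: ideal_gen_sub; first exact: ideal_gen_ideal.
  by move=> _ [x [y [Kx Jy ->]]]; apply: sub_ideal_gen; exists x, y; split; auto.
move=> x Px; have [||Kx Jgx] := @ideal_prod_sub K J g fK.1 fJ.1 _ _ x Px.
- by move=> y z /Kg gy /Kg; apply: am_funB.
- by move=> y a /Kg; apply: am_funM.
by rewrite /= eg // ef.
Qed.

Let amq_ind (Pr : amQuot -> Prop) : (forall f, Pr (pi f)) -> forall q, Pr q.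
Proof. by move=> Pf q; rewrite -[q]reprK; apply: Pf. Qed.

Fact amq_addA : associative amq_add.
Proof.
elim/amq_ind=> f; elim/amq_ind=> g; elim/amq_ind=> h.
by rewrite !pi_add; apply/pi_eq/am_equivW => x _ _ /=; rewrite addrA.
Qed.
Fact amq_addC : commutative amq_add.
Proof.
elim/amq_ind=> f; elim/amq_ind=> g.
by rewrite !pi_add; apply/pi_eq/am_equivW => x _ _ /=; rewrite addrC.
Qed.
Fact amq_add0 : left_id amq_zero amq_add.
Proof.
elim/amq_ind=> f.
by rewrite !pi_add; apply/pi_eq/am_equivW => x _ _ /=; rewrite mul0r add0r.
Qed.
Fact amq_addN : left_inverse amq_zero amq_opp amq_add.
Proof.
elim/amq_ind=> f.
by rewrite pi_opp !pi_add; apply/pi_eq/am_equivW => x _ _ /=; rewrite mul0r addNr.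
Qed.
HB.instance Definition _ :=
  GRing.isZmodule.Build amQuot amq_addA amq_addC amq_add0 amq_addN.

Fact amq_mulA : associative amq_mul.
Proof.
elim/amq_ind=> f; elim/amq_ind=> g; elim/amq_ind=> h.
by rewrite !pi_mul; apply/pi_eq/am_equivW.
Qed.
Fact amq_mul1 : left_id amq_one amq_mul.
Proof.
elim/amq_ind=> f.
by rewrite !pi_mul; apply/pi_eq/am_equivW => x _ _ /=; rewrite mul1r.
Qed.
Fact amq_mulr1 : right_id amq_one amq_mul.
Proof.
elim/amq_ind=> f.
by rewrite !pi_mul; apply/pi_eq/am_equivW => x _ _ /=; rewrite mul1r.
Qed.
Fact amq_mulDl : left_distributive amq_mul +%R.
Proof.
elim/amq_ind=> f; elim/amq_ind=> g; elim/amq_ind=> h.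
by rewrite [_ + _]pi_add !pi_mul [RHS]pi_add; apply/pi_eq/am_equivW.
Qed.
Fact amq_mulDr : right_distributive amq_mul +%R.
Proof.
elim/amq_ind=> f; elim/amq_ind=> g; elim/amq_ind=> h.
rewrite [_ + _]pi_add !pi_mul [RHS]pi_add.
apply/pi_eq/am_equivW => x _ [/am_comp_dom[gx fgx] /am_comp_dom[hx fhx]] /=.
by rewrite am_funD.
Qed.
Fact amq_one_neq0 : amq_one != amq_zero.
Proof.
apply/eqP => /pi_eq /asboolP[J [fJ _ _ /= e]].
have /eqP : 1 = 0 :> U by apply: (AMfilter_ann fJ) => x /e; rewrite mul0r.
by rewrite oner_eq0.
Qed.
HB.instance Definition _ := GRing.Zmodule_isNzRing.Build amQuot
  amq_mulA amq_mul1 amq_mulr1 amq_mulDl amq_mulDr amq_one_neq0.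

(* u is sent to the left multiplication by u, which is right U-linear. *)
Definition amq_of (u : U) : amQuot := pi (am_lmul u).

Definition extended_centroid : set amQuot :=
  [set q | forall q', q * q' = q' * q].

End AmitsurMartindale.
Arguments extended_centroid : clear implicits.

Record prime_ideal (R : nzRingType) (P : set R) : Prop := PrimeIdeal {
  prime_two_sided : two_sided_ideal P;
  prime_proper : P <> setT;
  prime_mul : forall I J : set R, two_sided_ideal I -> two_sided_ideal J ->
    (forall x y, I x -> J y -> P (x * y)) -> I `<=` P \/ J `<=` P }.

Record Spec (R : nzRingType) := MkSpec {
  spec_set :> set R;
  specP : prime_ideal spec_set }.

Section SpecTopology.
Variable R : nzRingType.
Implicit Types P Q : Spec R.

HB.instance Definition _ := gen_eqMixin (Spec R).
HB.instance Definition _ := gen_choiceMixin (Spec R).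

Lemma spec_ideal P : two_sided_ideal P.
Proof. exact: prime_two_sided (specP P). Qed.

Lemma spec_not1 P : ~ spec_set P 1.
Proof.
move=> P1; apply: (prime_proper (specP P)); apply/seteqP; split=> // x _.
by rewrite -[x]mulr1; apply: idealMl (spec_ideal P) _ _ P1.
Qed.

Lemma spec_inj P Q : (P : set R) = Q -> P = Q.
Proof.
by case: P Q => [P hP] [Q hQ] /= e; subst Q; rewrite (Prop_irrelevance hP hQ).
Qed.

Definition VSpec (I : set R) : set (Spec R) := [set P | I `<=` P].

Definition zariski_open (A : set (Spec R)) := exists I, A = ~` VSpec I.

Fact zariski_openT : zariski_open setT.
Proof.
exists setT; apply/esym/seteqP; split=> // P _ PT.
by apply: (@spec_not1 P); apply: PT.
Qed.

Fact zariski_openI : setI_closed zariski_open.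
Proof.
move=> _ _ [I ->] [J ->].
exists [set x | forall P, VSpec I P \/ VSpec J P -> spec_set P x].
rewrite -setCU; congr (~` _); apply/seteqP; split=> [P PIJ x|P PK]; first exact.
suff : ideal_gen I `<=` P \/ ideal_gen J `<=` P.
  by move=> [] /(subset_trans (@sub_ideal_gen _ _)) ?; [left|right].
apply: (prime_mul (specP P)); try exact: ideal_gen_ideal.
move=> x y Ix Jy; apply: PK => Q [IQ|JQ].
  by apply: idealMr (spec_ideal Q) _ _ _; apply: Ix IQ; apply: spec_ideal.
by apply: idealMl (spec_ideal Q) _ _ _; apply: Jy JQ; apply: spec_ideal.
Qed.

Fact zariski_open_bigU (I : Type) (f : I -> set (Spec R)) :
  (forall i, zariski_open (f i)) -> zariski_open (\bigcup_i f i).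
Proof.
move=> fo; exists [set x | exists i J, f i = ~` VSpec J /\ J x].
apply/seteqP; split=> [P [i _ fiP] PJ|P PJ].
  have [J fiJ] := fo i; move: fiP; rewrite fiJ; apply=> x Jx.
  by apply: PJ; exists i, J.
apply: contrapT => nP; apply: PJ => x [i [J [fiJ Jx]]].
have : ~ f i P by move=> fP; apply: nP; exists i.
by rewrite fiJ => /contrapT; apply.
Qed.

HB.instance Definition _ := isOpenTopological.Build (Spec R)
  zariski_openT zariski_openI zariski_open_bigU.

Lemma zariski_closedP (A : set (Spec R)) : closed A <-> exists I, A = VSpec I.
Proof.
rewrite -openC; split=> [[I e]|[I ->]]; last by exists I.
by exists I; apply: setC_inj.
Qed.
End SpecTopology.

Section QuotientAlgebra.
Variables (k : closedFieldType) (R : algType k) (P : Spec R).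
Let iP := spec_ideal P.

Definition quot_equiv : rel R := fun x y => `[< spec_set P (x - y) >].

Fact quot_equiv_refl : reflexive quot_equiv.
Proof. by move=> x; apply/asboolP; rewrite subrr; apply: ideal0. Qed.

Fact quot_equiv_sym : ssrbool.symmetric quot_equiv.
Proof.
by move=> x y; apply/asboolP/asboolP => /(idealN iP); rewrite opprB.
Qed.

Fact quot_equiv_trans : transitive quot_equiv.
Proof.
move=> y x z /asboolP xy /asboolP yz; apply/asboolP.
by have := idealD iP xy yz; rewrite addrA subrK.
Qed.

Canonical quot_equiv_rel :=
  EquivRel quot_equiv quot_equiv_refl quot_equiv_sym quot_equiv_trans.

(* R / P, made a k-algebra below. *)
Definition quotAlg := {eq_quot quot_equiv}%qT.
HB.instance Definition _ := Choice.on quotAlg.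
HB.instance Definition _ := EqQuotient.on quotAlg.
Local Notation pi := (\pi_quotAlg)%qT.

Lemma quot_eq x y : spec_set P (x - y) <-> pi x = pi y.
Proof. by split=> [?|/eqmodP /asboolP]; first by apply/eqmodP/asboolP. Qed.

Definition quot_zero : quotAlg := pi 0.
Definition quot_one : quotAlg := pi 1.
Definition quot_add (a b : quotAlg) : quotAlg := pi (repr a + repr b).
Definition quot_opp (a : quotAlg) : quotAlg := pi (- repr a).
Definition quot_mul (a b : quotAlg) : quotAlg := pi (repr a * repr b).
Definition quot_scale (c : k) (a : quotAlg) : quotAlg := pi (c *: repr a).

Let reprP x : spec_set P (repr (pi x) - x).
Proof. by apply/quot_eq; rewrite reprK. Qed.

Lemma quot_piD x y : quot_add (pi x) (pi y) = pi (x + y).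
Proof. by apply/quot_eq; rewrite opprD addrACA; apply: (idealD iP); apply: reprP. Qed.

Lemma quot_piN x : quot_opp (pi x) = pi (- x).
Proof. by apply/quot_eq; rewrite -opprD; apply: (idealN iP); apply: reprP. Qed.

Lemma quot_piM x y : quot_mul (pi x) (pi y) = pi (x * y).
Proof.
apply/quot_eq; set x' := repr _; set y' := repr _.
have -> : x' * y' - x * y = (x' - x) * y' + x * (y' - y).
  by rewrite mulrBl mulrBr addrA subrK.
by apply: (idealD iP); [apply: (idealMr iP)|apply: (idealMl iP)]; apply: reprP.
Qed.

Lemma quot_piZ c x : quot_scale c (pi x) = pi (c *: x).
Proof. by apply/quot_eq; rewrite -scalerBr -mulr_algl; apply: (idealMl iP); apply: reprP. Qed.

Let quot_ind (Pr : quotAlg -> Prop) : (forall x, Pr (pi x)) -> forall q, Pr q.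
Proof. by move=> Px q; rewrite -[q]reprK; apply: Px. Qed.

Fact quot_addA : associative quot_add.
Proof.
by elim/quot_ind=> x; elim/quot_ind=> y; elim/quot_ind=> z; rewrite !quot_piD addrA.
Qed.
Fact quot_addC : commutative quot_add.
Proof. by elim/quot_ind=> x; elim/quot_ind=> y; rewrite !quot_piD addrC. Qed.
Fact quot_add0 : left_id quot_zero quot_add.
Proof. by elim/quot_ind=> x; rewrite quot_piD add0r. Qed.
Fact quot_addN : left_inverse quot_zero quot_opp quot_add.
Proof. by elim/quot_ind=> x; rewrite quot_piN quot_piD addNr. Qed.
HB.instance Definition _ :=
  GRing.isZmodule.Build quotAlg quot_addA quot_addC quot_add0 quot_addN.

Fact quot_mulA : associative quot_mul.
Proof.
by elim/quot_ind=> x; elim/quot_ind=> y; elim/quot_ind=> z; rewrite !quot_piM mulrA.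
Qed.
Fact quot_mul1 : left_id quot_one quot_mul.
Proof. by elim/quot_ind=> x; rewrite quot_piM mul1r. Qed.
Fact quot_mulr1 : right_id quot_one quot_mul.
Proof. by elim/quot_ind=> x; rewrite quot_piM mulr1. Qed.
Fact quot_mulDl : left_distributive quot_mul +%R.
Proof.
elim/quot_ind=> x; elim/quot_ind=> y; elim/quot_ind=> z.
by rewrite [_ + _]quot_piD !quot_piM [RHS]quot_piD mulrDl.
Qed.
Fact quot_mulDr : right_distributive quot_mul +%R.
Proof.
elim/quot_ind=> x; elim/quot_ind=> y; elim/quot_ind=> z.
by rewrite [_ + _]quot_piD !quot_piM [RHS]quot_piD mulrDr.
Qed.
Fact quot_one_neq0 : quot_one != quot_zero.
Proof. by apply/eqP => /quot_eq; rewrite subr0; apply: spec_not1. Qed.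
HB.instance Definition _ := GRing.Zmodule_isNzRing.Build quotAlg
  quot_mulA quot_mul1 quot_mulr1 quot_mulDl quot_mulDr quot_one_neq0.

Fact quot_scaleA a b x : quot_scale a (quot_scale b x) = quot_scale (a * b) x.
Proof. by elim/quot_ind: x => x; rewrite !quot_piZ scalerA. Qed.
Fact quot_scale1 : left_id 1 quot_scale.
Proof. by elim/quot_ind=> x; rewrite quot_piZ scale1r. Qed.
Fact quot_scaleDr : right_distributive quot_scale +%R.
Proof.
move=> c; elim/quot_ind=> x; elim/quot_ind=> y.
by rewrite [_ + _]quot_piD !quot_piZ [RHS]quot_piD scalerDr.
Qed.
Fact quot_scaleDl x : {morph quot_scale^~ x : a b / a + b}.
Proof.
by elim/quot_ind: x => x a b; rewrite !quot_piZ [RHS]quot_piD scalerDl.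
Qed.
HB.instance Definition _ := GRing.Zmodule_isLmodule.Build k quotAlg
  quot_scaleA quot_scale1 quot_scaleDr quot_scaleDl.

Fact quot_scaleAl (c : k) (x y : quotAlg) : c *: (x * y) = c *: x * y.
Proof.
elim/quot_ind: x => x; elim/quot_ind: y => y.
change (quot_scale c (quot_mul (pi x) (pi y)) =
        quot_mul (quot_scale c (pi x)) (pi y)).
by rewrite !(quot_piM, quot_piZ) scalerAl.
Qed.
HB.instance Definition _ := GRing.Lmodule_isLalgebra.Build k quotAlg quot_scaleAl.

Fact quot_scaleAr (c : k) (x y : quotAlg) : c *: (x * y) = x * (c *: y).
Proof.
elim/quot_ind: x => x; elim/quot_ind: y => y.
change (quot_scale c (quot_mul (pi x) (pi y)) =
        quot_mul (pi x) (quot_scale c (pi y))).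
by rewrite !(quot_piM, quot_piZ) scalerAr.
Qed.
HB.instance Definition _ := GRing.Lalgebra_isAlgebra.Build k quotAlg quot_scaleAr.

Lemma quot_additive x y : pi (x + y) = pi x + pi y.
Proof. by rewrite [RHS]quot_piD. Qed.
Lemma quot_multiplicative x y : pi (x * y) = pi x * pi y.
Proof. by rewrite [RHS]quot_piM. Qed.
Lemma quot_scalar (c : k) : pi c%:A = c%:A :> quotAlg.
Proof. by rewrite [RHS]quot_piZ. Qed.
End QuotientAlgebra.

(* C(U) = k: the canonical map from k to C(U) is onto; it is injective since
   U is nonzero. *)
Definition trivial_centroid (k : closedFieldType) (U : algType k) : Prop :=
  extended_centroid U = range (fun c : k => amq_of (c%:A : U)).

Definition RatSpec (k : closedFieldType) (R : algType k) : set (Spec R) :=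
  [set P | trivial_centroid (quotAlg P)].
Arguments RatSpec {k} R _.

Lemma trivial_centroidP (k : closedFieldType) (U : algType k) :
  trivial_centroid U <->
  forall f : amHom U, (forall g, am_equiv (am_mul f g) (am_mul g f)) ->
    exists c : k, am_equiv f (am_lmul (c%:A : U)).
Proof.
split=> [tU f fC|tU].
  have : extended_centroid U (\pi_(amQuot U) f)%qT.
    move=> q; rewrite -[q]reprK [LHS]pi_mul [RHS]pi_mul; apply/pi_eq; exact: fC.
  by rewrite tU => -[c _ /pi_eq e]; exists c; rewrite am_equiv_sym.
apply/seteqP; split=> [q qC|_ [c _ <-] q].
  have [|c e] := tU (repr q).
    by move=> g; apply/pi_eq; rewrite -!pi_mul reprK; apply: qC.
  by exists c => //; rewrite -[RHS]reprK; apply/pi_eq; rewrite am_equiv_sym.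
rewrite -[q]reprK [LHS]pi_mul [RHS]pi_mul; apply/pi_eq/am_equivW.
move=> x /am_comp_dom[qx _] _ /=.
by rewrite !mulr_algl -[c *: x]mulr_algr am_funM // mulr_algr.
Qed.

Section Transport.
Variables (k : closedFieldType) (U V : algType k) (phi : U -> V) (psi : V -> U).
Hypotheses (phiK : cancel phi psi) (psiK : cancel psi phi).
Hypotheses (phiD : {morph phi : x y / x + y}) (phiM : {morph phi : x y / x * y}).

Let psiD : {morph psi : x y / x + y}.
Proof. by move=> x y; apply: (canLR phiK); rewrite phiD !psiK. Qed.
Let psiM : {morph psi : x y / x * y}.
Proof. by move=> x y; apply: (canLR phiK); rewrite phiM !psiK. Qed.
Let phi0 : phi 0 = 0.
Proof. by apply: (addrI (phi 0)); rewrite -phiD !addr0. Qed.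
Let phiB : {morph phi : x y / x - y}.
Proof. by move=> x y; apply: (addIr (phi y)); rewrite -phiD !subrK. Qed.

Lemma transport_filter (I : set V) : AMfilter I -> AMfilter (phi @^-1` I).
Proof.
move=> fI; have iI := fI.1; apply: AMfilterP; first split=> /=.
- by rewrite phi0; apply: ideal0.
- by move=> x y; rewrite phiB; apply: idealB.
- by move=> a x; rewrite phiM; apply: idealMl.
- by move=> a x; rewrite phiM; apply: idealMr.
move=> u uI; rewrite /= -[u]phiK -[0]phiK; congr psi; rewrite phi0.
apply: (AMfilter_ann fI) => x Ix.
by rewrite -[x]psiK -phiM uI /= ?psiK.
Qed.

Program Definition transport (f : amHom V) : amHom U :=
  @AMHom U (phi @^-1` (am_dom f)) (fun x => psi (f (phi x))) _ _ _.
Next Obligation. by move=> f; apply: transport_filter; apply: am_domP. Qed.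
Next Obligation. by move=> f x y fx fy /=; rewrite phiD am_funD // psiD. Qed.
Next Obligation. by move=> f x a fx /=; rewrite phiM am_funM // psiM phiK. Qed.
End Transport.

Lemma trivial_centroid_iso (k : closedFieldType) (U V : algType k)
    (phi : U -> V) (psi : V -> U) :
    cancel phi psi -> cancel psi phi -> {morph phi : x y / x + y} ->
    {morph phi : x y / x * y} -> (forall c : k, phi c%:A = c%:A) ->
  trivial_centroid U -> trivial_centroid V.
Proof.
move=> phiK psiK phiD phiM phiA /trivial_centroidP tU; apply/trivial_centroidP.
have psiD : {morph psi : x y / x + y}.
  by move=> x y; apply: (canLR phiK); rewrite phiD !psiK.
have psiM : {morph psi : x y / x * y}.
  by move=> x y; apply: (canLR phiK); rewrite phiM !psiK.
move=> f fC; pose tf := transport phiK psiK phiD phiM f.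
have [g|c] := tU tf.
  have /asboolP[J [fJ Jf Jg e]] := fC (transport psiK phiK psiD psiM g).
  apply/asboolP; exists (phi @^-1` J `&` (am_dom (am_mul tf g) `&` am_dom (am_mul g tf))).
  split; first apply: AMfilterI; first exact: transport_filter fJ.
  - by apply: AMfilterI; exact: am_domP.
  - by move=> x [_ []].
  - by move=> x [_ []].
  by move=> x [/= /e + _]; rewrite /= phiK => ->; rewrite phiK.
move=> /asboolP[J [fJ Jf _ e]]; exists c; apply/asboolP.
exists (psi @^-1` J); split=> //; first exact: transport_filter fJ.
  by move=> y /Jf /=; rewrite psiK.
move=> y /e /=; rewrite psiK => /(congr1 phi).
by rewrite psiK phiM psiK phiA.
Qed.

Record algAction (k : closedFieldType) (G : groupType) (R : algType k) :=
  AlgAction {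
    act_fun :> G -> {lrmorphism R -> R};
    act1 : forall r, act_fun 1%g r = r;
    actM : forall g h r, act_fun (g * h)%g r = act_fun g (act_fun h r) }.

Section Rationality.
Variables (k : closedFieldType) (G : affineAlgGroup k) (R : algType k).

(* GL(V) is identified with GL_n by means of a basis e of V; the last condition
   makes V stable under G, with g acting on V by the matrix rho g. *)
Definition rational_subspace (a : algAction G R) (V : set R) :=
  exists n (e : 'I_n -> R) (rho : G -> GL k n),
  [/\ V = [set r | exists c : 'I_n -> k, r = \sum_i c i *: e i],
      forall c : 'I_n -> k, \sum_i c i *: e i = 0 -> forall i, c i = 0,
      algGroup_hom rho &
      forall g j, a g (e j) = \sum_i val (rho g) i j *: e i].

Definition rational_action (a : algAction G R) :=
  \bigcup_(V in rational_subspace a) V = setT.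
End Rationality.

Section ActionOnSpec.
Variables (k : closedFieldType) (G : groupType) (R : algType k).
Variable a : algAction G R.
Implicit Types (g : G) (P : Spec R).

Lemma actK g : cancel (a g) (a g^-1%g).
Proof. by move=> r; rewrite -actM mulVg act1. Qed.

Lemma actVK g : cancel (a g^-1%g) (a g).
Proof. by move=> r; rewrite -actM mulgV act1. Qed.

Lemma act_imageE g (I : set R) r : (a g @` I) r <-> I (a g^-1%g r).
Proof.
by split=> [[x Ix <-]|Ir]; [rewrite actK | exists (a g^-1%g r); rewrite ?actVK].
Qed.

Lemma act_ideal g (I : set R) : two_sided_ideal I -> two_sided_ideal (a g @` I).
Proof.
move=> iI; split=> [|x y|b x|b x]; rewrite !act_imageE.
- by rewrite raddf0; apply: ideal0.
- by rewrite raddfB; apply: idealB.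
- by rewrite rmorphM; apply: idealMl.
- by rewrite rmorphM; apply: idealMr.
Qed.

Fact spec_act_subproof g P : prime_ideal (a g @` P).
Proof.
split; first exact: act_ideal (spec_ideal P).
  move=> eT; have : (a g @` P) 1 by rewrite eT.
  by rewrite act_imageE rmorph1; apply: spec_not1.
move=> I J iI iJ IJ.
have [] : a g^-1%g @` I `<=` P \/ a g^-1%g @` J `<=` P.
- apply: (prime_mul (specP P)); try exact: act_ideal.
  move=> _ _ [x Ix <-] [y Jy <-]; rewrite -rmorphM -act_imageE; exact: IJ.
- by move=> IP; left=> x Ix; rewrite act_imageE; apply: IP; exists x.
- by move=> JP; right=> x Jx; rewrite act_imageE; apply: JP; exists x.
Qed.

Definition spec_act g P : Spec R := MkSpec (spec_act_subproof g P).

Lemma Rat_stable g P : RatSpec R P -> RatSpec R (spec_act g P).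
Proof.
pose P' := spec_act g P.
pose phi (q : quotAlg P) : quotAlg P' := (\pi_(quotAlg P') (a g (repr q)))%qT.
pose psi (q : quotAlg P') : quotAlg P := (\pi_(quotAlg P) (a g^-1%g (repr q)))%qT.
have phiE x : phi (\pi_(quotAlg P) x)%qT = (\pi_(quotAlg P') (a g x))%qT.
  by apply/quot_eq; rewrite -raddfB; exists (repr (\pi_(quotAlg P) x)%qT - x) => //; apply/quot_eq; rewrite reprK.
have psiE x : psi (\pi_(quotAlg P') x)%qT = (\pi_(quotAlg P) (a g^-1%g x))%qT.
  by apply/quot_eq; rewrite -raddfB -act_imageE; apply/(@quot_eq _ _ P'); rewrite reprK.
apply: (@trivial_centroid_iso _ _ _ phi psi).
- by move=> q; rewrite -[q]reprK phiE psiE actK.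
- by move=> q; rewrite -[q]reprK psiE phiE actVK.
- move=> p q; rewrite -[p]reprK -[q]reprK.
  by rewrite -quot_additive !phiE raddfD quot_additive.
- move=> p q; rewrite -[p]reprK -[q]reprK.
  by rewrite -quot_multiplicative !phiE rmorphM quot_multiplicative.
by move=> c; rewrite -quot_scalar phiE linearZ rmorph1 quot_scalar.
Qed.

Definition rat_act g (P : RatSpec R) : RatSpec R :=
  exist _ (spec_act g (val P)) (mem_set (Rat_stable g (set_mem (valP P)))).

Definition rat_orbit (P : RatSpec R) : set (RatSpec R) := [set rat_act g P | g in setT].
End ActionOnSpec.

(* closure A, coerced to a type, carries the subspace topology. *)
Definition open_in_closure (X : topologicalType) (A : set X) :=
  open [set x : closure A | A (val x)].

Lemma open_in_closureP (X : topologicalType) (A : set X) :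
  open_in_closure A <-> exists2 O, open O & A = O `&` closure A.
Proof.
split=> [[O oO e]|[O oO e]]; exists O => //.
  have eO x (cx : x \in closure A) : O x = A x.
    exact: (congr1 (fun D : set (closure A) => D (exist _ x cx)) e).
  apply/seteqP; split=> [x Ax|x [Ox /mem_set cx]]; last by rewrite -(eO x).
  by have Cx := subset_closure Ax; rewrite -(eO x) ?inE in Ax *.
apply/seteqP; split=> -[x cx] /=; last by rewrite {1}e => -[].
by move=> Ox; rewrite e; split=> //; apply: set_mem.
Qed.

Definition locally_closed_point (X : topologicalType) (x : X) :=
  open_in_closure [set x].

(* Main.v *)
Require Import Defs.
From HB Require Import structures.
From mathcomp Require Import all_boot all_order all_algebra mpoly.
From mathcomp Require Import boolp classical_sets topology_structure subtype_topology.

(* Let O_Y be the ideal of those F in R[x_1, ..., x_n] (G being closed in k^n)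
   with F(g) in g.P for all g in a closed subset Y of G. Since G is Noetherian, it
   is a finite union of sets Y with O_Y prime. Eliminating one central variable at
   a time, one finds an ideal B of R not contained in the contraction p of O_Y
   such that every rational prime Q of R containing p but not B is hit by a point:
   there is v in k^n with O_Y(v) contained in Q. Here rationality of Q replaces the
   Nullstellensatz: modulo Q, a polynomial of minimal degree in an ideal is a
   constant times a polynomial over k, which has a root. Such a v is a point g of
   G, and g.P is contained in Q. The same argument, applied to an ideal D not
   contained in O_Y, moreover gives D(v) not contained in Q; for D the ideal of the
   F with F(g) in g.I, where I witnesses that P is locally closed, this forces
   g.P = Q. The translates of B then cut out the complement of the orbit in its
   closure. *)

Set Implicit Arguments.
Unset Strict Implicit.
Unset Printing Implicit Defensive.
Import GRing.Theory Defs.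
Local Open Scope classical_set_scope.
Local Open Scope ring_scope.

(** * Ideals of polynomial rings *)

Section PrimeIdeals.
Variable A : nzRingType.
Implicit Types I J P : set A.

Definition prime_elt P :=
  [/\ two_sided_ideal P, ~ P 1 &
      forall a b, (forall s, P (a * s * b)) -> P a \/ P b].

Lemma ideal_sum I (T : Type) (r : seq T) (p : pred T) (F : T -> A) :
  two_sided_ideal I -> (forall i, p i -> I (F i)) -> I (\sum_(i <- r | p i) F i).
Proof.
by move=> iI IF; apply: (big_ind I) => //; [apply: ideal0|move=> x y; apply: idealD].
Qed.

Lemma idealBr I x y : two_sided_ideal I -> I y -> I (x - y) <-> I x.
Proof.
move=> iI Iy; split=> [Ixy|Ix]; last exact: idealB.
by rewrite -(subrK y x); apply: idealD.
Qed.

(** Primeness for ideals is applied to the largest [I] with [I A b] inside [P] and the largest [J]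
    with [I A J] inside [P]; they contain [a] and [b]. *)
Lemma prime_ideal_elt P : prime_ideal P -> prime_elt P.
Proof.
case=> iP PT PM; split=> // [P1|a b Pab].
  by apply: PT; apply/seteqP; split=> // x _; rewrite -[x]mulr1; apply: idealMl.
pose I : set A := [set x | forall s, P (x * s * b)].
pose J : set A := [set y | forall x s, I x -> P (x * s * y)].
have iI : two_sided_ideal I.
  split=> [s|x y Ix Iy s|c x Ix s|c x Ix s] /=.
  - by rewrite !mul0r; apply: ideal0.
  - by rewrite !mulrBl; apply: idealB.
  - by rewrite -!mulrA; apply: (idealMl iP); rewrite mulrA.
  - by rewrite -(mulrA x).
have iJ : two_sided_ideal J.
  split=> [x s _|y z Jy Jz x s Ix|c y Jy x s Ix|c y Jy x s Ix] /=.
  - by rewrite mulr0; apply: ideal0.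
  - by rewrite mulrBr; apply: (idealB iP); [apply: Jy|apply: Jz].
  - by rewrite mulrA -(mulrA x); apply: Jy.
  - by rewrite mulrA; apply: (idealMr iP); apply: Jy.
have [x y Ix Jy||] := PM I J iI iJ.
- by have := Jy x 1 Ix; rewrite mulr1.
- by left; apply: a0.
- by move=> JP; right; apply: JP => x s Ix; apply: Ix.
Qed.

Lemma prime_elt_sub P I J : prime_elt P -> two_sided_ideal I ->
  ~ I `<=` P -> ~ J `<=` P -> (forall x y, I x -> J y -> P (x * y)) -> False.
Proof.
case=> iP _ PM iI /existsNP[x /not_implyP[Ix Px]] /existsNP[y /not_implyP[Jy Py]].
move=> IJ; have [s|//|//] := PM x y.
by apply: IJ => //; apply: idealMr.
Qed.

Lemma prime_eltI P I J : prime_elt P -> two_sided_ideal I -> two_sided_ideal J ->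
  ~ I `<=` P -> ~ J `<=` P -> ~ I `&` J `<=` P.
Proof.
move=> pP iI iJ nI nJ IJP; apply: (prime_elt_sub pP iI nI nJ) => x y Ix Jy.
by apply: IJP; split; [apply: idealMr|apply: idealMl].
Qed.
End PrimeIdeals.

(** * One polynomial variable: contractions, minimal degrees, pseudo-division *)

Section Coefficients.
Variable A : nzRingType.
Implicit Types (I q : set A) (P L : set {poly A}) (f g h : {poly A}).

Definition contraction P : set A := [set a | P a%:P].
Definition coefs_in I : set {poly A} := [set f | forall i, I f`_i].

Lemma contraction_ideal P : two_sided_ideal P -> two_sided_ideal (contraction P).
Proof.
move=> iP; split=> [|x y Px Py|a x Px|a x Px]; rewrite /contraction /=.
- by rewrite polyC0; apply: ideal0.
- by rewrite polyCB; apply: idealB.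
- by rewrite polyCM; apply: idealMl.
- by rewrite polyCM; apply: idealMr.
Qed.

Lemma coefs_in_ideal I : two_sided_ideal I -> two_sided_ideal (coefs_in I).
Proof.
move=> iI; split=> [i|f g If Ig i|a f If i|a f If i].
- by rewrite coef0; apply: ideal0.
- by rewrite coefB; apply: idealB.
- by rewrite coefM; apply: ideal_sum => // j _; apply: idealMl.
- by rewrite coefM; apply: ideal_sum => // j _; apply: idealMr.
Qed.

Lemma poly_sumC f : f = \sum_(i < size f) (f`_i)%:P * 'X^i.
Proof. by rewrite -[LHS]coefK poly_def; apply: eq_bigr => i _; rewrite mul_polyC. Qed.

Lemma coefs_in_contraction P : two_sided_ideal P ->
  coefs_in (contraction P) `<=` P.
Proof.
move=> iP f Pf; rewrite [f]poly_sumC; apply: ideal_sum => // i _.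
by apply: idealMr => //; apply: Pf.
Qed.

(** The variable is central, so its powers move past [g]; primeness in [{poly A}] need only be
    tested with constants in the middle. *)
Lemma ideal_mul_const P f g : two_sided_ideal P ->
  (forall s, P (f * s%:P * g)) -> forall h, P (f * h * g).
Proof.
move=> iP Pfg h; rewrite [h]poly_sumC mulr_sumr mulr_suml; apply: ideal_sum => // i _.
by rewrite mulrA -mulrA -commr_polyXn mulrA; apply: idealMr.
Qed.

Lemma contraction_prime P : prime_elt P -> prime_elt (contraction P).
Proof.
case=> iP P1 PM; split=> //; first exact: contraction_ideal.
move=> a b Pab; apply: PM; apply: ideal_mul_const => // s.
by rewrite -!polyCM; apply: Pab.
Qed.

Lemma coefs_prime_const P f g : prime_elt P ->
  (forall s, P (f * s%:P * g)) -> P f \/ P g.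
Proof. by case=> iP _ PM Pfg; apply: PM; apply: ideal_mul_const. Qed.

(** The cancellation step of the division arguments below. Sizes are only bounded, so vanishing top
    coefficients need no separate case. *)
Lemma size_cancel_lead f g d m : (size f <= (d + m).+1)%N -> (size g <= d.+1)%N ->
  f`_(d + m) = g`_d -> (size (f - g * 'X^m)%R <= d + m)%N.
Proof.
move=> sf sg e; apply/leq_sizeP => j; rewrite leq_eqVlt coefB coefMXn => /predU1P[<-|lj].
  by rewrite ltnNge leq_addl /= addnK e subrr.
rewrite (leq_sizeP _ _ sf) // ltnNge (leq_trans (leq_addl d m) (ltnW lj)) /=.
by rewrite (leq_sizeP _ _ sg) ?subrr // ltn_subRL addnC.
Qed.

(** Take [d] least. A top coefficient in [q] could be removed without leaving [L], which contains
    [coefs_in q], and the degree would drop. *)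
Lemma min_degree L q : two_sided_ideal L -> two_sided_ideal q ->
    coefs_in q `<=` L -> ~ L `<=` coefs_in q ->
  exists d f, [/\ L f, (size f <= d.+1)%N, ~ q f`_d &
    forall h, L h -> (size h <= d)%N -> coefs_in q h].
Proof.
move=> iL iq qL /existsNP[f0 /not_implyP[Lf0 qf0]].
pose S m := `[< exists f, [/\ L f, (size f <= m)%N & ~ coefs_in q f] >].
have exS : exists m, S m by exists (size f0); apply/asboolP; exists f0.
case: (ex_minnP exS) => -[|d] /asboolP[f [Lf sf qf]] dmin.
  exfalso; apply: qf; move: sf; rewrite leqn0 size_poly_eq0 => /eqP -> i.
  by rewrite coef0; apply: ideal0.
have min h : L h -> (size h <= d)%N -> coefs_in q h.
  move=> Lh sh; apply: contrapT => qh.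
  by have := dmin d; rewrite ltnn => H; have /H : S d by apply/asboolP; exists h.
exists d, f; split=> // qfd; apply: qf.
have qm : coefs_in q ((f`_d)%:P * 'X^d).
  move=> i; rewrite coefMXn coefC; case: ltnP => _; first exact: ideal0.
  by case: eqP => _ //; apply: ideal0.
have := coefs_in_ideal iq => icq.
apply/(idealBr _ icq qm)/min; first by apply: idealB => //; apply: qL.
rewrite -[d in (_ <= d)%N]add0n; apply: size_cancel_lead => //.
  by rewrite (leq_trans (size_polyC_leq1 _)).
by rewrite coefC.
Qed.

Lemma min_degree_gt0 L q d f : contraction L `<=` q -> L f ->
  (size f <= d.+1)%N -> ~ q f`_d -> (0 < d)%N.
Proof.
move=> Lq Lf sf; case: d sf => // /size1_polyC ef nq; exfalso; apply: nq.
by apply: Lq; rewrite /contraction /= -ef.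
Qed.

(* Pseudo-reduction by [fb], whose leading coefficient is outside [Q], keeps the
   non-constant coefficients in [Q]. *)
Lemma lying_over P d fb (Q : set A) :
    two_sided_ideal P -> prime_elt Q -> contraction P `<=` Q ->
    (forall h, P h -> (size h <= d)%N -> coefs_in (contraction P) h) ->
    P fb -> (size fb <= d.+1)%N -> ~ Q fb`_d -> (0 < d)%N ->
  forall h, P h -> (forall i, (0 < i)%N -> Q h`_i) -> Q h`_0.
Proof.
move=> iP pQ pQs dmin Pfb sfb Qb d0 h; have [iQ _ QM] := pQ.
have [n] := ubnP (size h); elim: n h => // m IH h /ltnSE sh Ph Qh.
have [lmd|/subnKC edm] := leqP m d.
  by apply: pQs; apply: dmin => //; apply: leq_trans sh lmd.
set j := (m - d.+1)%N in edm; rewrite -edm addSn in sh IH.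
have [s|//|//] := QM fb`_d h`_0.
pose h' := (fb`_d * s)%:P * h - fb * (s * h`_(d + j))%:P * 'X^j.
(* Here [0 < d] matters: [d + j] is the index of a non-constant coefficient. *)
have Qhd : Q h`_(d + j) by apply: Qh; rewrite addn_gt0 d0.
have Q2 i : Q (fb * (s * h`_(d + j))%:P * 'X^j)`_i.
  rewrite coefMXn; case: ltnP => _; first exact: ideal0.
  by rewrite coefMC mulrA; apply: idealMl.
have h'E i : h'`_i = fb`_d * s * h`_i - (fb * (s * h`_(d + j))%:P * 'X^j)`_i.
  by rewrite coefB coefCM.
have : Q h'`_0.
  apply: IH.
  - apply: size_cancel_lead.
    + by rewrite mul_polyC; apply: leq_trans (size_scale_leq _ _) sh.
    + apply/leq_sizeP => i li; rewrite coefMC (leq_sizeP _ _ sfb) ?mul0r //.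
    + by rewrite coefCM coefMC mulrA.
  - apply: idealB => //; first exact: idealMl.
    by do 2 apply: idealMr => //.
  - by move=> i i0; rewrite h'E; apply: idealB => //; apply: idealMl => //; apply: Qh.
by rewrite h'E => /(idealBr _ iQ (Q2 0%N)).
Qed.

(* Pseudo-division of [f] by [g]: the congruence [e s g = g s e] lets all the
   factors [e] be moved past [g], so that the quotient [h] is on the left. *)
Lemma pseudo_division q g d m f b :
    prime_elt q -> (size g <= d.+1)%N -> ~ q g`_d ->
    (forall s, coefs_in q ((g`_d)%:P * s%:P * g - g * s%:P * (g`_d)%:P)) ->
    (size f <= d + m)%N -> ~ q b ->
  exists w h, [/\ ~ q (b * w), (size h <= m)%N,
    forall i, m = i.+1 -> h`_i = f`_(d + i) * w &
    forall s, exists2 r : {poly A}, (size r <= d)%N &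
      coefs_in q (f * w%:P * s%:P * (g`_d)%:P - h * s%:P * g - r)].
Proof.
move=> pq sg qe comm; have [iq _ qM] := pq; have icq := coefs_in_ideal iq.
set e := g`_d in qe comm *.
elim: m f b => [|m IH] f b sf qb.
  rewrite addn0 in sf.
  exists 1, 0; split=> //; [by rewrite mulr1|by rewrite size_poly0|] => s.
  exists (f * (s * e)%:P); last first.
    by rewrite mulr1 mul0r mul0r subr0 polyCM mulrA subrr; apply: ideal0.
  by apply/leq_sizeP => i li; rewrite coefMC (leq_sizeP _ _ sf) ?mul0r.
(* Passing [b * t * e] to the recursive call keeps [b] times the product of all multipliers outside
   [q]. *)
have [t qbt] : exists t, ~ q (b * t * e).
  by apply: contrapT => H; have [s|//|//] := qM b e; apply: contrapT => H'; apply: H; exists s.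
pose f1 := f * (t * e)%:P - (f`_(d + m) * t)%:P * g * 'X^m.
have sf1 : (size f1 <= d + m)%N.
  apply: size_cancel_lead.
  - by apply/leq_sizeP => i li; rewrite coefMC (leq_sizeP _ _ sf) ?mul0r // addnS.
  - by rewrite mul_polyC; apply: leq_trans (size_scale_leq _ _) sg.
  - by rewrite coefMC coefCM mulrA.
have [w1 [h1 [qw1 sh1 _ hs]]] := IH f1 _ sf1 qbt.
exists (t * e * w1), ((f`_(d + m) * t * e * w1)%:P * 'X^m + h1); split.
- by rewrite !mulrA.
- rewrite (leq_trans (size_polyD _ _)) // geq_max (leq_trans sh1) // andbT.
  apply/leq_sizeP => i li; rewrite coefMXn coefC ltnNge (ltnW li) /=.
  by rewrite subn_eq0 leqNgt li.
- move=> i [<-]; rewrite coefD coefMXn ltnn subnn coefC eqxx.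
  by rewrite (leq_sizeP _ _ sh1) // addr0 !mulrA.
move=> s; have [r sr rP] := hs s; exists r => //.
(* Reducing [f] leaves [g] in front of [e], while the new term of the quotient puts [e] in front of
   [g]; [comm] at [w1 * s] bridges the two. *)
have := idealMl icq (f`_(d + m) * t)%:P (idealMr icq 'X^m (comm (w1 * s))).
move=> c1; have := idealB icq rP c1.
pose F : {poly A} := (f`_(d + m) * t)%:P.
have Xc (x : {poly A}) : 'X^m * x = x * 'X^m by rewrite commr_polyXn.
have f1E : f1 * w1%:P * s%:P * e%:P =
    f * (t * e * w1)%:P * s%:P * e%:P - F * (g * (w1 * s)%:P * e%:P * 'X^m).
  by rewrite /f1 -/F !polyCM !mulrBl -!mulrA Xc -!mulrA.
have hE : ((f`_(d + m) * t * e * w1)%:P * 'X^m + h1) * s%:P * g =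
    F * (e%:P * (w1 * s)%:P * g * 'X^m) + h1 * s%:P * g.
  by rewrite /F !polyCM !mulrDl -!mulrA Xc -!mulrA.
rewrite f1E hE -/F mulrBl mulrBr.
set x1 := f * _ * _ * _; set x2 := F * _; set x3 := F * _; set x4 := h1 * _ * _.
suff -> : x1 - x2 - x4 - r - (x3 - x2) = x1 - (x3 + x4) - r by [].
rewrite opprB opprD !addrA (addrAC _ (- r) x2) (addrAC _ (- x4) x2) subrK.
by rewrite (addrAC _ (- r)) (addrAC _ (- x4)).
Qed.

Lemma ideal_add_ideal I J : two_sided_ideal I -> two_sided_ideal J ->
  two_sided_ideal [set z | exists x y, [/\ I x, J y & z = x + y]].
Proof.
move=> iI iJ; split=> [|_ _ [x [y [Ix Jy ->]]] [x' [y' [Ix' Jy' ->]]]|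
    a _ [x [y [Ix Jy ->]]]|a _ [x [y [Ix Jy ->]]]].
- by exists 0, 0; rewrite addr0; split=> //; apply: ideal0.
- by exists (x - x'), (y - y'); rewrite opprD addrACA; split=> //; apply: idealB.
- by exists (a * x), (a * y); rewrite mulrDr; split=> //; apply: idealMl.
- by exists (x * a), (y * a); rewrite mulrDl; split=> //; apply: idealMr.
Qed.

(** Let [g] have minimal degree in [D] modulo [q]. Dividing an element of minimal degree in [P] by
    [g] leaves a remainder in [coefs_in q], so [P] contains [h * s * g] for all constants [s], but
    not the quotient [h]. Hence [P] contains [g], and division by [g] puts all of [D] in [P]. *)
Lemma incomparability P D : prime_elt P -> two_sided_ideal D -> P `<=` D ->
    ~ P `<=` coefs_in (contraction P) -> contraction D `<=` contraction P ->
  D `<=` P.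
Proof.
move=> pP iD PD nP Dq; have pq := contraction_prime pP.
have [iP _ _] := pP; have [iq _ qM] := pq; have icq := coefs_in_ideal iq.
have qP := coefs_in_contraction iP.
set q := contraction P in Dq nP pq iq qM icq qP.
have [d [p [Pp sp qp pmin]]] := min_degree iP iq qP nP.
have [|d' [g [Dg sg qg gmin]]] := min_degree iD iq (subset_trans qP PD).
  by move=> Dq'; apply: nP => x /PD /Dq'.
have d'0 := min_degree_gt0 Dq Dg sg qg.
have ld'd : (d' <= d)%N.
  rewrite leqNgt; apply/negP => ld; apply: qp.
  by apply: gmin; [apply: PD|apply: leq_trans sp ld].
(* The coefficients in degree [d'] cancel, so minimality of [d'] applies to the difference. *)
have comm s : coefs_in q ((g`_d')%:P * s%:P * g - g * s%:P * (g`_d')%:P).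
  apply: gmin; first by apply: idealB => //; [apply: idealMl|do 2 apply: idealMr => //].
  apply/leq_sizeP => i; rewrite leq_eqVlt => /predU1P[<-|li].
    by rewrite coefB -mulrA !coefCM !coefMC mulrA subrr.
  rewrite coefB -mulrA !coefCM !coefMC.
  by rewrite (leq_sizeP _ _ sg i li) !mulr0 !mul0r subrr.
have sp' : (size p <= d' + (d - d').+1)%N by rewrite addnS subnKC.
have [w [h [qw sh hE hP]]] := pseudo_division pq sg qg comm sp' qp.
have Pg : P g.
  have [s||//] := coefs_prime_const (f := h) (g := g) pP.
    have [r sr rP] := hP s.
    have Pf : P (p * w%:P * s%:P * (g`_d')%:P) by do 3 apply: idealMr => //.
    have Dr : D r.
      rewrite -[r](subKr (p * w%:P * s%:P * (g`_d')%:P - h * s%:P * g)).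
      apply: (idealB iD); last exact: PD (qP _ rP).
      by apply: (idealB iD); [apply: PD|apply: idealMl].
    rewrite -[h * _ * _](subKr (p * w%:P * s%:P * (g`_d')%:P)).
    apply: (idealB iP) => //; rewrite -[X in P X](subrK r).
    by apply: (idealD iP); apply: qP => //; apply: gmin.
  (* The degree of [h] is at most [d - d'], below [d] since [0 < d'], and its coefficient there is
     the top coefficient of [p] times [w], outside [q]. *)
  move=> Ph; exfalso; have := pmin _ Ph; rewrite -ltnS.
  have -> : (size h < d.+1)%N.
    by rewrite ltnS (leq_trans sh) // ltn_subrL d'0 (leq_trans d'0).
  by move=> /(_ isT (d - d')%N); rewrite (hE (d - d')%N) // subnKC.
move=> f; have [n] := ubnP (size f); elim: n f => // n IH f /ltnSE sf Df.
have [lnd|/subnKC en] := leqP n d'.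
  by apply: qP; apply: gmin => //; apply: leq_trans sf lnd.
set j := (n - d'.+1)%N in en; rewrite -en addSn in sf IH.
have [s|//|//] := coefs_prime_const (f := f) (g := (g`_d')%:P) pP.
have Pgs : P ((f`_(d' + j) * s)%:P * g * 'X^j).
  by apply: idealMr => //; apply: idealMl.
rewrite -[X in P X](subrK ((f`_(d' + j) * s)%:P * g * 'X^j)).
apply: (idealD iP) => //; rewrite -mulrA -polyCM; apply: IH.
  rewrite ltnS; apply: size_cancel_lead.
  - by apply/leq_sizeP => i li; rewrite coefMC (leq_sizeP _ _ sf) ?mul0r.
  - by rewrite mul_polyC; apply: leq_trans (size_scale_leq _ _) sg.
  - by rewrite coefMC coefCM mulrA.
by apply: (idealB iD); [apply: idealMr|apply: PD].
Qed.
End Coefficients.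

(* For a prime [Q] of a [k]-algebra [A]: a bimodule map from the ideal of [A / Q]
   generated by [u] to [A / Q] is the multiplication by a scalar. *)
Definition rational_elt (k : fieldType) (A : nzRingType) (phi : k -> A) (Q : set A) :=
  forall u v, ~ Q u ->
    (forall r : seq (A * A), Q (\sum_(x <- r) x.1 * u * x.2) ->
                             Q (\sum_(x <- r) x.1 * v * x.2)) ->
  exists c, Q (v - phi c * u).

(** * Evaluation of one variable at scalars, modulo a prime *)

Section Rationality.
Variables (k : closedFieldType) (A : nzRingType) (phi : {rmorphism k -> A}).
Hypothesis phiC : forall c x, phi c * x = x * phi c.
Implicit Types (Q : set A) (f g h : {poly A}).

Lemma hornerM_phi f g c : (f * g).[phi c] = f.[phi c] * g.[phi c].
Proof. by rewrite hornerM_comm // /comm_poly phiC. Qed.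

(** Relations over [A] lift to constant polynomials. With [horner_prime], this lets the induction on
    variables pass to the pulled-back prime. *)
Lemma rational_horner Q c : rational_elt phi Q ->
  rational_elt (polyC \o phi) [set f : {poly A} | Q f.[phi c]].
Proof.
move=> rQ u v /= qu uv; have [r|c' Qc'] := rQ _ v.[phi c] qu; last first.
  by exists c'; rewrite hornerD hornerN hornerM_phi hornerC.
have := uv [seq (x.1%:P, x.2%:P) | x <- r].
rewrite !big_map /= !horner_sum.
have e (w : {poly A}) : \sum_(x <- r) (x.1%:P * w * x.2%:P).[phi c] =
    \sum_(x <- r) x.1 * w.[phi c] * x.2.
  by apply: eq_bigr => x _; rewrite !hornerM_phi !hornerC.
by rewrite !e.
Qed.

Lemma horner_prime Q c : prime_elt Q -> prime_elt [set f : {poly A} | Q f.[phi c]].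
Proof.
case=> iQ Q1 QM; split=> /=; last 1 first.
- move=> f g Qfg; apply: QM => s; have := Qfg s%:P.
  by rewrite !hornerM_phi hornerC.
- split=> [|f g|g f|g f] /=.
  + by rewrite horner0; apply: ideal0.
  + by rewrite !hornerE; apply: idealB.
  + by rewrite hornerM_phi; apply: idealMl.
  + by rewrite hornerM_phi; apply: idealMr.
- by rewrite hornerC.
Qed.

Lemma poly_XsubC_central c f : f * ('X - (phi c)%:P) = ('X - (phi c)%:P) * f.
Proof.
rewrite mulrBr mulrBl commr_polyX; congr (_ - _).
by apply/polyP => i; rewrite coefMC coefCM phiC.
Qed.

Lemma horner_factor f c : exists g, f = g * ('X - (phi c)%:P) + (f.[phi c])%:P.
Proof.
have /factor_theorem[g e] : root (f - (f.[phi c])%:P) (phi c).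
  by rewrite /root !hornerE subrr.
by exists g; rewrite -e subrK.
Qed.

(** Dividing by a linear factor at one point keeps the vanishing modulo [Q] at all other points,
    since differences of distinct scalars are invertible. *)
Lemma horner_coefs_in Q f : two_sided_ideal Q ->
  (forall c : k, Q f.[phi c]) -> coefs_in Q f.
Proof.
(* The roots of [B] are the points already divided out; vanishing is only required at its nonroots,
   which exist as [k] is infinite. *)
move=> iQ Qf; pose B : {poly k} := 1.
have {Qf} : forall c, ~~ root B c -> Q f.[phi c] by move=> c _; apply: Qf.
have : B != 0 by apply: oner_neq0.
have [n] := ubnP (size f); elim: n f B => // n IH f B /ltnSE sf B0 Qf.
have [c Bc] : exists c, ~~ root B c by apply/closed_nonrootP.
have [g e] := horner_factor f c.
have icQ := coefs_in_ideal iQ.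
have Qc : coefs_in Q (f.[phi c])%:P.
  by move=> i; rewrite coefC; case: eqP => _; [apply: Qf|apply: ideal0].
have [->|f0] := eqVneq f 0; first exact: ideal0.
rewrite e; apply: (idealD icQ) => //; apply: (idealMr icQ).
apply: (IH _ (B * ('X - c%:P))).
- have [->|g0] := eqVneq g 0; first by rewrite size_poly0 (leq_trans _ sf) // size_poly_gt0.
  have : size (f - (f.[phi c])%:P) = (size g).+1.
    by rewrite {1}e addrK size_Mmonic ?monicXsubC // size_XsubC addn2.
  move=> eg; apply: leq_trans sf; rewrite -eg.
  rewrite (leq_trans (size_polyD _ _)) // size_polyN geq_max leqnn.
  by rewrite (leq_trans (size_polyC_leq1 _)) // size_poly_gt0.
- by rewrite mulf_neq0 // polyXsubC_eq0.
move=> c'; rewrite rootM negb_or root_XsubC => /andP[Bc' cc'].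
have Qg : Q (g.[phi c'] * phi (c' - c)).
  have := Qf _ Bc'; rewrite {1}e hornerD hornerM_phi hornerXsubC hornerC -rmorphB.
  by move=> Qs; rewrite -[X in Q X](addrK f.[phi c]); apply: (idealB iQ) => //; apply: Qf.
have := idealMr iQ (phi (c' - c)^-1) Qg.
by rewrite -mulrA -rmorphM mulfV ?rmorph1 ?mulr1 // subr_eq0.
Qed.

Lemma rational_root Q (L : set {poly A}) : prime_elt Q -> rational_elt phi Q ->
    two_sided_ideal L -> coefs_in Q `<=` L -> contraction L `<=` Q ->
  exists c, forall h, L h -> Q h.[phi c].
Proof.
move=> pQ rQ iL QL LQ; have [iQ _ QM] := pQ; have icQ := coefs_in_ideal iQ.
have [LcQ|nL] := pselect (L `<=` coefs_in Q).
  exists 0 => h /LcQ Qh; rewrite horner_coef; apply: ideal_sum => // i _.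
  by apply: idealMr => //; apply: Qh.
have [d [f [Lf sf Qf fmin]]] := min_degree iL iQ QL nL.
have d0 := min_degree_gt0 LQ Lf sf Qf.
(* By minimality of [d], a relation killing the top coefficient of [f] modulo [Q] kills all
   coefficients; rationality makes each of them a scalar multiple of the top one. *)
have /choice[c cP] : forall i : nat, exists c, Q (f`_i - phi c * f`_d).
  move=> i; apply: rQ => // r Qr.
  have Lr : L (\sum_(x <- r) x.1%:P * f * x.2%:P).
    by apply: ideal_sum => // x _; apply: idealMr => //; apply: idealMl.
  have rE j : (\sum_(x <- r) x.1%:P * f * x.2%:P)`_j = \sum_(x <- r) x.1 * f`_j * x.2.
    by rewrite coef_sum; apply: eq_bigr => x _; rewrite coefMC coefCM.
  pose t := (\sum_(x <- r) x.1 * f`_d * x.2)%:P * 'X^d.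
  have Qt : coefs_in Q t.
    by apply: (idealMr icQ) => j; rewrite coefC; case: eqP => _ //; apply: ideal0.
  have Qrt : coefs_in Q (\sum_(x <- r) x.1%:P * f * x.2%:P - t).
    apply: fmin; first by apply: idealB => //; apply: QL.
    rewrite -[d in (_ <= d)%N]add0n; apply: size_cancel_lead; last 1 first.
    - by rewrite rE coefC.
    - apply/leq_sizeP => j lj; rewrite rE big1 // => x _.
      by rewrite (leq_sizeP _ _ sf) // mulr0 mul0r.
    - by rewrite (leq_trans (size_polyC_leq1 _)).
  by rewrite -rE; have := idealD icQ Qrt Qt; rewrite subrK; apply.
pose g : {poly k} := \poly_(i < d.+1) (if i == d then 1 else c i).
have sg : size g = d.+1.
  by rewrite /g size_poly_eq // eqxx oner_neq0.
have fg : coefs_in Q (f - (f`_d)%:P * map_poly phi g).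
  move=> i; rewrite coefB coefCM coef_map coef_poly /=.
  have [li|li] := ltnP i d.+1; last first.
    by rewrite (leq_sizeP _ _ sf) // rmorph0 mulr0 subrr; apply: ideal0.
  by case: eqP => [->|_]; [rewrite rmorph1 mulr1 subrr; apply: ideal0|rewrite -phiC].
have [x gx] : exists x, root g x by apply/closed_rootP; rewrite sg eqSS -lt0n.
have /factor_theorem[p ep] := gx.
have p0 : p != 0.
  by apply: contra_eq_neq sg => p0; rewrite ep p0 mul0r size_poly0.
have sp : size p = d.
  by apply: succn_inj; rewrite -sg ep size_Mmonic ?monicXsubC // size_XsubC addn2.
(* Multiplying the remainder [h.[phi x]] by [s], the top coefficient of [f] and the cofactor [p]
   gives an element of [L] of degree below [d], hence in [coefs_in Q]. The leading coefficient of
   [p] is invertible, so primeness applies. *)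
exists x => h Lh.
have [s|//|//] := QM h.[phi x] f`_d.
have [h1 eh] := horner_factor h x.
pose Y : {poly A} := 'X - (phi x)%:P.
have Yc a b : a * (Y * b) = Y * (a * b) by rewrite mulrA poly_XsubC_central -mulrA.
have eg : map_poly phi g = Y * map_poly phi p.
  by rewrite ep rmorphM rmorphB /= map_polyX map_polyC poly_XsubC_central.
rewrite -/Y in eh.
have Lk : L ((h.[phi x] * s * f`_d)%:P * map_poly phi p).
  have -> : (h.[phi x] * s * f`_d)%:P * map_poly phi p =
      h * ((s * f`_d)%:P * map_poly phi p) -
      h1 * s%:P * ((f`_d)%:P * map_poly phi g).
    by rewrite {2}eh eg mulrDl addrC !polyCM -!mulrA !Yc addKr.
  apply: (idealB iL); first exact: idealMr.
  apply: (idealMl iL); rewrite -[X in L X](subKr f).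
  by apply: (idealB iL) => //; apply: QL.
have sk : (size ((h.[phi x] * s * f`_d)%:P * map_poly phi p)%R <= d)%N.
  by rewrite mul_polyC (leq_trans (size_scale_leq _ _)) // -sp size_poly.
have := fmin _ Lk sk (size p).-1; rewrite coefCM coef_map -/(lead_coef p) /=.
move/(idealMr iQ (phi (lead_coef p)^-1)).
by rewrite -(mulrA _ (phi _)) -rmorphM mulfV ?lead_coef_eq0 // rmorph1 mulr1.
Qed.

(* [D] keeps the evaluation point away from a proper closed subset, which is what
   makes an induction on the number of variables possible. *)
Lemma generic_point (P D : set {poly A}) : prime_elt P -> two_sided_ideal D ->
    ~ D `<=` P ->
  exists B, [/\ two_sided_ideal B, ~ B `<=` contraction P &
    forall Q, prime_elt Q -> rational_elt phi Q -> contraction P `<=` Q ->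
      ~ B `<=` Q ->
      exists c, (forall f, P f -> Q f.[phi c]) /\ ~ (forall f, D f -> Q f.[phi c])].
Proof.
move=> pP iD DP; have [iP _ _] := pP; have pp := contraction_prime pP.
have [ip _ _] := pp; have pinP := coefs_in_contraction iP.
have [Pp|nP] := pselect (P `<=` coefs_in (contraction P)).
  have [f /not_implyP[Df /existsNP[i fi]]] : exists f, ~ (D f -> coefs_in (contraction P) f).
    by apply/existsNP => H; apply: DP => f /H /pinP.
  (* Here [P] vanishes modulo [Q] at every scalar, so only an element of [D] with a coefficient
     outside [Q] is needed. *)
  exists [set b | exists2 h, D h & b = h`_i]; split.
  - split=> [|_ _ [g Dg ->] [h Dh ->]|a _ [g Dg ->]|a _ [g Dg ->]].
    + by exists 0; [apply: ideal0|rewrite coef0].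
    + by exists (g - h); [apply: idealB|rewrite coefB].
    + by exists (a%:P * g); [apply: idealMl|rewrite coefCM].
    + by exists (g * a%:P); [apply: idealMr|rewrite coefMC].
  - by move=> /(_ f`_i) H; apply: fi; apply: H; exists f.
  move=> Q [iQ _ _] _ pQ /existsNP[_ /not_implyP[[h Dh ->] Qh]].
  have [c Qc] : exists c, ~ Q h.[phi c].
    by apply/existsNP => H; apply: Qh; apply: horner_coefs_in.
  exists c; split=> [g /Pp Pg|/(_ h Dh)//].
  rewrite horner_coef; apply: ideal_sum => // j _; apply: idealMr => //.
  by apply: pQ; apply: Pg.
have [d [p [Pp sp qp pmin]]] := min_degree iP ip pinP nP.
have d0 := min_degree_gt0 (fun _ Px => Px) Pp sp qp.
(* An element of [B] outside [Q] is the top coefficient that [lying_over] asks for. *)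
pose B : set A := [set b | exists h, [/\ P h, (size h <= d.+1)%N & b = h`_d]].
have iB : two_sided_ideal B.
  split=> [|_ _ [g [Pg sg ->]] [h [Ph sh ->]]|a _ [g [Pg sg ->]]|a _ [g [Pg sg ->]]].
  - by exists 0; rewrite coef0 size_poly0; split=> //; apply: ideal0.
  - exists (g - h); rewrite coefB (leq_trans (size_polyD _ _)) ?size_polyN ?geq_max ?sg //.
    by split=> //; apply: idealB.
  - exists (a%:P * g); rewrite coefCM mul_polyC (leq_trans (size_scale_leq _ _)) //.
    by split=> //; rewrite -mul_polyC; apply: idealMl.
  - exists (g * a%:P); rewrite coefMC; split=> //; first exact: idealMr.
    by apply/leq_sizeP => j lj; rewrite coefMC (leq_sizeP _ _ sg) ?mul0r.
pose D' : set {poly A} := [set z | exists x y, [/\ P x, D y & z = x + y]].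
have iD' : two_sided_ideal D' by apply: ideal_add_ideal.
have PD' : P `<=` D' by move=> x Px; exists x, 0; rewrite addr0; split=> //; apply: ideal0.
(* Elements of [contraction D'] are unchanged by evaluation: where [P] vanishes modulo [Q] and such
   an element does not, [D] cannot vanish. *)
have nD' : ~ contraction D' `<=` contraction P.
  move=> H; apply: DP => y Dy; apply: (incomparability pP iD' PD' nP H).
  by exists 0, y; rewrite add0r; split=> //; apply: ideal0.
exists (B `&` contraction D'); split.
- by apply: idealI => //; apply: contraction_ideal.
- apply: prime_eltI => //; first exact: contraction_ideal.
  by move=> /(_ p`_d) H; apply: qp; apply: H; exists p.
move=> Q pQ rQ pq /existsNP[b /not_implyP[[[p' [Pp' sp' eb]] [x [y [Px Dy exy]]]] Qb]].
have [iQ _ _] := pQ; have icQ := coefs_in_ideal iQ.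
pose L : set {poly A} := [set z | exists x y, [/\ P x, coefs_in Q y & z = x + y]].
have iL : two_sided_ideal L by apply: ideal_add_ideal.
have [||c Lc] := rational_root pQ rQ iL.
- by move=> z Qz; exists 0, z; rewrite add0r; split=> //; apply: ideal0.
(* A constant in [P + coefs_in Q] comes from an element of [P] whose non-constant coefficients lie
   in [Q]. *)
- move=> z [f [g [Pf Qg ez]]].
  have Qfi i : (0 < i)%N -> Q f`_i.
    move=> i0; rewrite -[f](addrK g) -ez coefB coefC gtn_eqF // sub0r.
    by apply: idealN => //; apply: Qg.
  have -> : z = f`_0 + g`_0 by rewrite -coefD -ez coefC.
  apply: (idealD iQ); last exact: Qg.
  by rewrite eb in Qb; apply: (lying_over iP pQ pq pmin Pp' sp' Qb d0).
have Pc f : P f -> Q f.[phi c].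
  by move=> Pf; apply: Lc; exists f, 0; rewrite addr0; split=> //; apply: ideal0.
exists c; split=> // Dc; apply: Qb.
by rewrite -(hornerC b (phi c)) exy hornerD; apply: idealD => //; [apply: Pc|apply: Dc].
Qed.
End Rationality.

(** * Iterated polynomial rings *)

(** The variable of index 0 is adjoined to the base ring first, so that induction on [n], for all
    [A], eliminates one variable at a time. *)
Fixpoint ipoly (n : nat) (A : nzRingType) : nzRingType :=
  if n is m.+1 then ipoly m {poly A} else A.

Fixpoint ipolyC n : forall A : nzRingType, A -> ipoly n A :=
  if n is m.+1 then fun A a => @ipolyC m {poly A} a%:P else fun A a => a.

Fixpoint ieval n : forall (A : nzRingType) (S : Type) (phi : S -> A) (v : nat -> S),
    ipoly n A -> A :=
  if n is m.+1 then
    fun A S phi v f =>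
      (@ieval m {poly A} S (polyC \o phi) (v \o succn) f).[phi (v 0%N)]
  else fun A S phi v f => f.

Definition icontraction n A (P : set (ipoly n A)) : set A :=
  [set a | P (ipolyC n a)].

Section IPolyRing.
Implicit Type A : nzRingType.

Lemma ipolyCM n A : {morph @ipolyC n A : a b / a * b}.
Proof. by elim: n A => //= n IH A a b; rewrite polyCM IH. Qed.

Lemma ipolyC0 n A : ipolyC n (0 : A) = 0.
Proof. by elim: n A => //= n IH A; rewrite polyC0 IH. Qed.

Lemma ipolyC1 n A : ipolyC n (1 : A) = 1.
Proof. by elim: n A => //= n IH A; rewrite polyC1 IH. Qed.

Lemma ipolyCB n A : {morph @ipolyC n A : a b / a - b}.
Proof. by elim: n A => //= n IH A a b; rewrite polyCB IH. Qed.

Lemma icontraction_ideal n A (P : set (ipoly n A)) :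
  two_sided_ideal P -> two_sided_ideal (icontraction P).
Proof.
move=> iP; split=> [|x y Px Py|a x Px|a x Px]; rewrite /icontraction /=.
- by rewrite ipolyC0; apply: ideal0.
- by rewrite ipolyCB; apply: idealB.
- by rewrite ipolyCM; apply: idealMl.
- by rewrite ipolyCM; apply: idealMr.
Qed.

Lemma icontraction_prime n A (P : set (ipoly n A)) :
  prime_elt P -> prime_elt (icontraction P).
Proof.
elim: n A P => //= n IH A P pP.
exact: (contraction_prime (IH _ _ pP)).
Qed.

Lemma ieval_ipolyC n A S (phi : S -> A) v a : ieval phi v (ipolyC n a) = a.
Proof. by elim: n A phi v a => //= n IH A phi v a; rewrite IH hornerC. Qed.

Lemma ievalD n A S (phi : S -> A) v : {morph @ieval n A S phi v : f g / f + g}.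
Proof. by elim: n A phi v => //= n IH A phi v f g; rewrite IH hornerD. Qed.

Lemma ievalB n A S (phi : S -> A) v : {morph @ieval n A S phi v : f g / f - g}.
Proof. by elim: n A phi v => //= n IH A phi v f g; rewrite IH hornerD hornerN. Qed.

Lemma ieval0 n A S (phi : S -> A) v : ieval phi v (0 : ipoly n A) = 0.
Proof. by rewrite -(ipolyC0 n) ieval_ipolyC. Qed.

Lemma ieval1 n A S (phi : S -> A) v : ieval phi v (1 : ipoly n A) = 1.
Proof. by rewrite -(ipolyC1 n) ieval_ipolyC. Qed.

Lemma ievalM n A S (phi : S -> A) v : (forall c x, phi c * x = x * phi c) ->
  {morph @ieval n A S phi v : f g / f * g}.
Proof.
elim: n A phi v => //= n IH A phi v phiC f g.
rewrite IH => [|c x /=]; first by rewrite hornerM_comm // /comm_poly phiC.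
by apply/polyP => i; rewrite coefMC coefCM phiC.
Qed.

Lemma ieval_ext n A S (phi : S -> A) v w f :
  (forall i, (i < n)%N -> v i = w i) -> @ieval n A S phi v f = ieval phi w f.
Proof.
elim: n A phi v w f => //= n IH A phi v w f vw.
by rewrite vw // (IH _ _ _ (w \o succn)) // => i li; apply: vw.
Qed.

(** * Left Noetherian rings and Hilbert's basis theorem *)

Definition left_ideal A (I : set A) :=
  [/\ I 0, forall x y, I x -> I y -> I (x - y) & forall a x, I x -> I (a * x)].

Lemma left_idealD A (I : set A) x y : left_ideal I -> I x -> I y -> I (x + y).
Proof.
by move=> [I0 IB _] Ix Iy; rewrite -[y]opprK -[- y]sub0r; apply: (IB) => //; apply: (IB).
Qed.

Lemma left_idealI A (I J : set A) :
  left_ideal I -> left_ideal J -> left_ideal (I `&` J).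
Proof.
move=> [I0 IB IM] [J0 JB JM]; split=> [//|x y [Ix Jx] [Iy Jy]|a x [Ix Jx]]; split.
- exact: (IB).
- exact: (JB).
- exact: (IM).
- exact: (JM).
Qed.

(** Generation by [s] is expressed through all left ideals containing [s], which avoids explicit
    linear combinations. *)
Definition left_noetherian A := forall I : set A, left_ideal I ->
  exists2 s : seq A, {in s, forall x, I x} &
    forall J, left_ideal J -> {in s, forall x, J x} -> I `<=` J.

Lemma left_noetherian_field (k : fieldType) : left_noetherian k.
Proof.
move=> I [I0 IB IM]; have [[x Ix x0]|H] := pselect (exists2 x, I x & x != 0).
  exists [:: x] => [y|J [_ _ JM] Jx y _]; first by rewrite inE => /eqP ->.
  by rewrite -(divfK x0 y); apply/JM/Jx; rewrite inE.
exists [::] => // J [J0 _ _] _ x Ix; have [->//|x0] := eqVneq x 0.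
by case: H; exists x.
Qed.

Section HilbertBasis.
Variables (A : nzRingType) (I : set {poly A}).
Hypotheses (nA : left_noetherian A) (lI : left_ideal I).

Definition leads (J : set {poly A}) d : set A :=
  [set a | exists f, [/\ J f, (size f <= d.+1)%N & a = f`_d]].

Lemma leads_ideal J d : left_ideal J -> left_ideal (leads J d).
Proof.
case=> J0 JB JM; split=> [|_ _ [f [Jf sf ->]] [g [Jg sg ->]]|a _ [f [Jf sf ->]]].
- by exists 0; rewrite coef0 size_poly0.
- exists (f - g); rewrite coefB (leq_trans (size_polyD _ _)) ?size_polyN ?geq_max ?sf //.
  by split=> //; apply: JB.
- exists (a%:P * f); rewrite coefCM mul_polyC (leq_trans (size_scale_leq _ _)) //.
  by split=> //; rewrite -mul_polyC; apply: JM.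
Qed.

Lemma leads_leq J d e : left_ideal J -> (d <= e)%N -> leads J d `<=` leads J e.
Proof.
move=> [_ _ JM] /subnKC <- _ [f [Jf sf ->]].
exists ('X^(e - d) * f); rewrite coefXnM ltnNge leq_addl addnK; split=> //; first exact: JM.
apply/leq_sizeP => j lj; rewrite coefXnM ltnNge (leq_trans (leq_addl d _) (ltnW lj)) /=.
by rewrite (leq_sizeP _ _ sf) // ltn_subRL addnC.
Qed.

(** The intersection with [I] ensures that cancelling a top coefficient of an element of [I] does
    not leave [I]. *)
Lemma leads_gen d : exists2 s : seq {poly A}, {in s, forall f, I f} &
  forall J, left_ideal J -> {in s, forall f, J f} ->
    leads I d `<=` leads (I `&` J) d.
Proof.
have [s sI sgen] := nA (leads_ideal d lI).
have [t tI st] : exists2 t : seq {poly A}, {in t, forall f, I f} &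
    {in s, forall a, exists f, [/\ f \in t, (size f <= d.+1)%N & a = f`_d]}.
  elim: s sI {sgen} => [|a s IH] sI; first by exists [::].
  have [|t tI st] := IH; first by move=> x xs; apply: sI; rewrite inE xs orbT.
  have [f [If sf ef]] := sI a (mem_head _ _).
  exists (f :: t) => [g|b]; rewrite inE => /predU1P[->|]; [by []|exact: tI| |].
    by exists f; rewrite mem_head.
  by move=> /st[g [gt sg eg]]; exists g; rewrite inE gt orbT.
exists t => // J lJ tJ; apply: sgen => [|a /st[f [ft sf ->]]].
  exact/leads_ideal/left_idealI.
by exists f; split=> //; split; [apply: tI|apply: tJ].
Qed.

Lemma hilbert_basis : exists2 s : seq {poly A}, {in s, forall x, I x} &
    forall J, left_ideal J -> {in s, forall x, J x} -> I `<=` J.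
Proof.
pose L : set A := [set a | exists d, leads I d a].
have lL : left_ideal L.
  split=> [|x y [d dx] [e ey]|a x [d dx]].
  - by exists 0%N; case: (leads_ideal 0 lI).
  - exists (maxn d e); case: (leads_ideal (maxn d e) lI) => _ + _; apply.
      exact: leads_leq lI (leq_maxl _ _) _ dx.
    exact: leads_leq lI (leq_maxr _ _) _ ey.
  - by exists d; case: (leads_ideal d lI) => _ _; apply.
(* The union [L] of an increasing chain is finitely generated, hence reached at some [N]; generators
   are needed only for degrees up to [N]. *)
have [N LN] : exists N, L `<=` leads I N.
  have [s sL sgen] := nA lL.
  suff [N sN] : exists N, {in s, forall a, leads I N a}.
    by exists N; apply: sgen => //; apply: leads_ideal.
  elim: s sL {sgen} => [|a s IH] sL; first by exists 0%N.
  have [|N sN] := IH; first by move=> x xs; apply: sL; rewrite inE xs orbT.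
  have [d da] := sL a (mem_head _ _).
  exists (maxn d N) => b; rewrite inE => /predU1P[->|/sN].
    exact: leads_leq lI (leq_maxl _ _) _ da.
  exact: leads_leq lI (leq_maxr _ _) _.
have [T TI Tgen] : exists2 T : seq {poly A}, {in T, forall f, I f} &
  forall J, left_ideal J -> {in T, forall f, J f} ->
    forall d, (d < N.+1)%N -> leads I d `<=` leads (I `&` J) d.
  elim: N.+1 => [|M [T TI Tgen]]; first by exists [::].
  have [s sI sgen] := leads_gen M.
  exists (s ++ T) => [f|J lJ sJ d]; first by rewrite mem_cat => /orP[/sI|/TI].
  rewrite ltnS leq_eqVlt => /predU1P[->|].
    by apply: sgen => // f fs; apply: sJ; rewrite mem_cat fs.
  by apply: Tgen => // f fs; apply: sJ; rewrite mem_cat fs orbT.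
exists T => // J lJ TJ f; have [n] := ubnP (size f); elim: n f => // n IH f /ltnSE sf If.
have [_ IB _] := lI; have [J0 _ _] := lJ.
have [e|f0] := eqVneq (size f) 0%N.
  by have -> : f = 0 by apply/eqP; rewrite -size_poly_eq0 e.
have [d ed] : exists d, size f = d.+1 by exists (size f).-1; rewrite prednK // lt0n.
have fd : leads I d f`_d by exists f; rewrite ed.
have lIJ := left_idealI lI lJ.
have [g [[Ig Jg] sg eg]] : leads (I `&` J) d f`_d.
  have [/Tgen H|/ltnW Nd] := ltnP d N.+1; first exact: H fd.
  apply: (leads_leq lIJ Nd); apply: (Tgen J) => //.
  by apply: LN; exists d.
rewrite -(subrK g f); apply: left_idealD => //; apply: IH; last exact: IB.
apply: leq_trans sf; rewrite ed ltnS; have := @size_cancel_lead _ f g d 0.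
by rewrite addn0 expr0 mulr1; apply=> //; rewrite ed.
Qed.
End HilbertBasis.

Lemma left_noetherian_ipoly n A : left_noetherian A -> left_noetherian (ipoly n A).
Proof.
by elim: n A => //= n IH A nA; apply: IH => I; apply: hilbert_basis.
Qed.
End IPolyRing.

(** * Points and polynomial functions in several variables *)

Section IPolyPoints.
Variable k : closedFieldType.

(** The ideal [B'] found over [{poly A}] becomes the [D] of [generic_point] for the remaining
    variable. The scalar [c] keeps [B'] outside the pulled-back prime of [{poly A}], where the
    induction hypothesis then applies. *)
Lemma generic_ipoint n (A : nzRingType) (phi : {rmorphism k -> A})
    (P D : set (ipoly n A)) : (forall c x, phi c * x = x * phi c) ->
    prime_elt P -> two_sided_ideal D -> ~ D `<=` P ->
  exists B, [/\ two_sided_ideal B, ~ B `<=` icontraction P &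
    forall Q, prime_elt Q -> rational_elt phi Q -> icontraction P `<=` Q ->
      ~ B `<=` Q ->
      exists v, (forall f, P f -> Q (ieval phi v f)) /\
                ~ (forall f, D f -> Q (ieval phi v f))].
Proof.
elim: n A phi P D => [|n IH] A phi P D phiC pP iD DP.
  by exists D; split=> // Q _ _ PQ DQ; exists (fun=> 0).
have polyphiC (c : k) (x : {poly A}) : (phi c)%:P * x = x * (phi c)%:P.
  by apply/polyP => i; rewrite coefMC coefCM phiC.
have [B' [iB' B'P H']] := IH {poly A} (polyC \o phi) P D polyphiC pP iD DP.
have [B [iB BP H]] := generic_point phiC (@icontraction_prime n {poly A} P pP) iB' B'P.
exists B; split=> // Q pQ rQ PQ BQ.
have [c [Pc Bc]] := H Q pQ rQ PQ BQ.
have [v [Pv Dv]] := H' _ (horner_prime phiC c pQ) (rational_horner phiC rQ) Pc Bc.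
by exists (fun i => if i is j.+1 then v j else c).
Qed.

Inductive pfun n : ((nat -> k) -> k) -> Prop :=
| pfun_const c : pfun n (fun=> c)
| pfun_var i : (i < n)%N -> pfun n (fun v => v i)
| pfun_add f g : pfun n f -> pfun n g -> pfun n (fun v => f v + g v)
| pfun_mul f g : pfun n f -> pfun n g -> pfun n (fun v => f v * g v).

Lemma pfun_sum n (T : Type) (r : seq T) F : (forall i, pfun n (F i)) ->
  pfun n (fun v => \sum_(i <- r) F i v).
Proof.
move=> nF; elim: r => [|x r IH].
  by under eq_fun do rewrite big_nil; apply: pfun_const.
by under eq_fun do rewrite big_cons; apply: pfun_add.
Qed.

Lemma pfun_exp n f m : pfun n f -> pfun n (fun v => f v ^+ m).
Proof.
move=> nf; elim: m => [|m IH]; first exact: pfun_const.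
by under eq_fun do rewrite exprS; apply: pfun_mul.
Qed.

Lemma pfun_prod n (T : Type) (r : seq T) F : (forall i, pfun n (F i)) ->
  pfun n (fun v => \prod_(i <- r) F i v).
Proof.
move=> nF; elim: r => [|x r IH].
  by under eq_fun do rewrite big_nil; apply: pfun_const.
by under eq_fun do rewrite big_cons; apply: pfun_mul.
Qed.

Lemma pfun_comp n m f (F : nat -> (nat -> k) -> k) :
  pfun n f -> (forall i, (i < n)%N -> pfun m (F i)) -> pfun m (fun v => f (F ^~ v)).
Proof.
move=> nf mF; elim: nf => [c|i /mF//|g h _ mg _ mh|g h _ mg _ mh].
- exact: pfun_const.
- exact: pfun_add.
- exact: pfun_mul.
Qed.

Lemma pfun_mpoly n (p : {mpoly k[n]}) : pfun n (fun v => p.@[fun i : 'I_n => v i]).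
Proof.
under eq_fun do rewrite mevalE.
apply: pfun_sum => m; apply: pfun_mul; first exact: pfun_const.
by apply: pfun_prod => i; apply: pfun_exp; apply: pfun_var.
Qed.

Lemma ipoly_of_pfun n f (A : nzRingType) (phi : {rmorphism k -> A}) :
    (forall c x, phi c * x = x * phi c) -> pfun n f ->
  exists F : ipoly n A, forall v, ieval phi v F = phi (f v).
Proof.
move=> phiC; elim=> [c|i li|g h _ [G eG] _ [H eH]|g h _ [G eG] _ [H eH]].
- by exists (ipolyC n (phi c)) => v; rewrite ieval_ipolyC.
- elim: n i li A phi {phiC} => // n IH [_|i li] A phi.
    by exists (ipolyC n 'X) => v /=; rewrite ieval_ipolyC hornerX.
  have [F eF] := IH i li {poly A} (polyC \o phi).
  by exists F => v /=; rewrite eF hornerC.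
- by exists (G + H) => v; rewrite ievalD eG eH rmorphD.
- by exists (G * H) => v; rewrite ievalM // eG eH rmorphM.
Qed.

(** Scalar functions are kept apart from coefficients in [A], so that a linear action can be applied
    to the coefficients alone. *)
Inductive pmap n (A : nzRingType) (phi : k -> A) : ((nat -> k) -> A) -> Prop :=
| pmap0 : pmap n phi (fun=> 0)
| pmap_term f a : pfun n f -> pmap n phi (fun v => phi (f v) * a)
| pmap_add F G : pmap n phi F -> pmap n phi G -> pmap n phi (fun v => F v + G v).

Lemma pmap_sum n (A : nzRingType) (phi : k -> A) (T : Type) (r : seq T) F :
  (forall i, pmap n phi (F i)) -> pmap n phi (fun v => \sum_(i <- r) F i v).
Proof.
move=> nF; elim: r => [|x r IH].
  by under eq_fun do rewrite big_nil; apply: pmap0.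
by under eq_fun do rewrite big_cons; apply: pmap_add.
Qed.

Lemma pmap_ipoly n (A : nzRingType) (phi : {rmorphism k -> A}) (F : ipoly n A) :
  (forall c x, phi c * x = x * phi c) -> pmap n phi (fun v => ieval phi v F).
Proof.
elim: n A phi F => [|n IH] A phi F phiC /=.
  have -> : (fun=> F) = (fun v : nat -> k => phi ((fun=> 1) v) * F).
    by apply/funext => v; rewrite rmorph1 mul1r.
  exact/pmap_term/pfun_const.
have polyphiC (c : k) (x : {poly A}) : (polyC \o phi) c * x = x * (polyC \o phi) c.
  by apply/polyP => i; rewrite coefMC coefCM phiC.
suff H G : pmap n (polyC \o phi) G ->
    pmap n.+1 phi (fun v => (G (v \o succn)).[phi (v 0%N)]).
  exact: (H _ (IH {poly A} (polyC \o phi) F polyphiC)).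
elim=> [|f p nf|{}G H _ IHG _ IHH].
- by under eq_fun do rewrite horner0; apply: pmap0.
- have -> : (fun v : nat -> k => ((polyC \o phi) (f (v \o succn)) * p).[phi (v 0%N)]) =
      (fun v => \sum_(i < size p) phi (f (v \o succn) * v 0%N ^+ i) * p`_i).
    apply/funext => v; rewrite /= hornerCM horner_coef mulr_sumr.
    by apply: eq_bigr => i _; rewrite rmorphM -mulrA -rmorphXn -[p`_i * _]phiC.
  apply: pmap_sum => i; apply: pmap_term; apply: pfun_mul; last exact/pfun_exp/pfun_var.
  by apply: (pfun_comp (F := fun i v => v i.+1) nf) => j lj; apply: pfun_var.
- by under eq_fun do rewrite hornerD; apply: pmap_add.
Qed.
End IPolyPoints.

(** * Orbits *)

Section RationalPrimes.
Variables (k : closedFieldType) (R : algType k) (Q : Spec R).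
Local Notation U := (quotAlg Q).
Local Notation pi := (\pi_(quotAlg Q))%qT.

Let pQ : prime_elt Q. Proof. exact/prime_ideal_elt/specP. Qed.

(** Sending sums of [x u y] to sums of [x v y] is a bimodule map on the ideal generated by [u]
    modulo [Q]. Its class in the ring of quotients is central, hence a scalar. *)
Lemma rational_Rat : RatSpec R Q -> rational_elt (in_alg R) Q.
Proof.
move=> /trivial_centroidP tQ u v Qu uv; have [iQ _ QM] := pQ.
pose S (w : R) (r : seq (R * R)) := \sum_(x <- r) x.1 * w * x.2.
pose rel (w w' : U) := exists r, w = pi (S u r) /\ w' = pi (S v r).
have Scat w r1 r2 : S w (r1 ++ r2) = S w r1 + S w r2 by rewrite /S big_cat.
have Sl w c r : S w [seq (c * x.1, x.2) | x <- r] = c * S w r.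
  by rewrite /S big_map mulr_sumr; apply: eq_bigr => x _ /=; rewrite !mulrA.
have Sr w c r : S w [seq (x.1, x.2 * c) | x <- r] = S w r * c.
  by rewrite /S big_map mulr_suml; apply: eq_bigr => x _ /=; rewrite !mulrA.
have relD w1 w1' w2 w2' : rel w1 w1' -> rel w2 w2' -> rel (w1 + w2) (w1' + w2').
  move=> [r1 [-> ->]] [r2 [-> ->]]; exists (r1 ++ r2).
  by rewrite !Scat !quot_additive.
have rell c w w' : rel w w' -> rel (c * w) (c * w').
  move=> [r [-> ->]]; exists [seq (repr c * x.1, x.2) | x <- r].
  by rewrite !Sl !quot_multiplicative reprK.
have relr c w w' : rel w w' -> rel (w * c) (w' * c).
  move=> [r [-> ->]]; exists [seq (x.1, x.2 * repr c) | x <- r].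
  by rewrite !Sr !quot_multiplicative reprK.
have rel0 : rel 0 0 by exists [::]; rewrite /S !big_nil.
have relB w1 w1' w2 w2' : rel w1 w1' -> rel w2 w2' -> rel (w1 - w2) (w1' - w2').
  by move=> r1 r2; apply: relD => //; rewrite -(mulN1r w2) -(mulN1r w2'); apply: rell.
have pi0 x : pi x = 0 <-> spec_set Q x.
  by rewrite -[x in X in _ <-> X]subr0; split=> /quot_eq.
have relF w w1 w2 : rel w w1 -> rel w w2 -> w1 = w2.
  move=> r1 r2; apply/eqP; rewrite -subr_eq0; apply/eqP.
  have [r [/esym + ->]] := relB _ _ _ _ r1 r2.
  by rewrite subrr !pi0; apply: uv.
pose I : set U := [set w | exists w', rel w w'].
have iI : two_sided_ideal I.
  split=> [|x y [x' rx] [y' ry]|c x [x' rx]|c x [x' rx]].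
  - by exists 0.
  - by exists (x' - y'); apply: relB.
  - by exists (c * x'); apply: rell.
  - by exists (x' * c); apply: relr.
have /choice[f fP] : forall w, exists w', I w -> rel w w'.
  move=> w; have [[w' rw]|nI] := pselect (I w); first by exists w'.
  by exists 0.
have fE w w' : rel w w' -> f w = w'.
  by move=> rw; apply: (relF w) => //; apply: fP; exists w'.
have relu t : rel (pi u * t) (pi v * t).
  by apply: relr; exists [:: (1, 1)]; rewrite /S !big_seq1 /= !mul1r !mulr1.
(* If [z] annihilates [I], it annihilates every [s * u]; as [u] is not in [Q], primeness makes [z]
   zero modulo [Q]. *)
have fI : AMfilter I.
  apply: AMfilterP => // z zI /=; rewrite -[z]reprK; apply/pi0.
  have [s|//|//] := QM (repr z) u; apply/pi0.
  rewrite quot_multiplicative quot_multiplicative reprK -mulrA; apply: zI.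
  by exists (pi s * pi v); apply: rell; rewrite -[pi u]mulr1 -[pi v]mulr1.
have fD x y : I x -> I y -> f (x + y) = f x + f y.
  by move=> /fP rx /fP ry; apply: fE; apply: relD.
have fM x c : I x -> f (x * c) = f x * c.
  by move=> /fP rx; apply: fE; apply: relr.
have fl c x : I x -> f (c * x) = c * f x.
  by move=> /fP rx; apply: fE; apply: rell.
pose F := AMHom fI fD fM.
have [|c] := tQ F.
  move=> g; apply: am_equivW => x Px _ /=; have ig := am_ideal g.
  (* On [c * y * z] with [y] in [am_dom g] and [z] in [I], both composites give [g (c * y) * f z].
     The factor [c] is carried along since [g] need not be left linear. *)
  suff [] : [/\ am_dom g x, I (g x), I x, am_dom g (f x) & f (g x) = g (f x)] by [].
  rewrite -[x]mul1r; move: (1 : U).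
  apply: (Px [set x | forall c, [/\ am_dom g (c * x), I (g (c * x)), I (c * x),
    am_dom g (f (c * x)) & f (g (c * x)) = g (f (c * x))]]).
    split=> [c|y z Iy Iz c|b y Iy c|b y Iy c].
    - have g0 : g 0 = 0 by rewrite -[0]subr0 am_funB ?subrr //; apply: ideal0.
      have f0 : f 0 = 0 by apply: fE.
      rewrite mulr0 g0 f0 g0; split=> //; by apply: ideal0.
    - have [gy Igy Ify gfy ey] := Iy c; have [gz Igz Ifz gfz ez] := Iz c.
      have fB s t : I s -> I t -> f (s - t) = f s - f t.
        by move=> /fP rx /fP ry; apply: fE; apply: relB.
      rewrite mulrBr fB // !am_funB // fB // ey ez.
      by split=> //; apply: idealB.
    - by rewrite mulrA; apply: Iy.
    - have [gy Igy Ify gfy ey] := Iy c.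
      rewrite mulrA (fM _ _ Ify) (am_funM b gy) (am_funM b gfy) (fM _ _ Igy) ey.
      by split=> //; apply: idealMr.
  move=> _ [y [z [gy Iz ->]]] c; rewrite mulrA; have gcy := idealMl ig c gy.
  rewrite (fl _ _ Iz) (am_funM z gcy) (am_funM (f z) gcy) (fl _ _ Iz).
  by split=> //; [apply: idealMr|apply: idealMl|apply: idealMl|apply: idealMr].
move=> /asboolP[J [fJ JI _ Je]]; exists c.
apply/quot_eq; rewrite /= quot_multiplicative quot_scalar.
apply/eqP; rewrite -subr_eq0; apply/eqP; apply: (AMfilter_ann fJ) => w Jw.
(* Comparing both maps at [u w] for [w] in [J] shows that [v - c u] annihilates [J]. *)
have Juw : J (pi u * w) by apply: idealMl => //; case: fJ.
have /= := Je _ Juw; rewrite (fE _ _ (relu w)) => e.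
by rewrite mulrBl -mulrA; apply/eqP; rewrite subr_eq0; apply/eqP.
Qed.
End RationalPrimes.

Section Orbit.
Variables (k : closedFieldType) (G : affineAlgGroup k) (R : algType k).
Variable a : algAction G R.
Hypothesis a_rational : rational_action a.
Local Notation n := (aff_dim (aag_affine G)).
Implicit Types (g h : G) (r : R) (Y Z : set G).

Lemma spec_actE g (S : Spec R) r :
  spec_set (spec_act a g S) r <-> spec_set S (a g^-1%g r).
Proof. exact: act_imageE. Qed.

Lemma spec_actM g h (S : Spec R) :
  spec_act a g (spec_act a h S) = spec_act a (g * h)%g S.
Proof.
by apply/spec_inj/seteqP; split=> r; rewrite !spec_actE invgM actM.
Qed.

Lemma spec_act1 (S : Spec R) : spec_act a 1%g S = S.
Proof. by apply/spec_inj/seteqP; split=> r; rewrite spec_actE invg1 act1. Qed.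

(** Entries beyond [n] are set to 0 to obtain the sequences that [ieval] takes; only the first [n]
    entries matter. *)
Definition point (x : 'rV[k]_n) : nat -> k :=
  fun i => if insub i is Some j then x ord0 j else 0.

Definition gpoint g := point (aff_coord (aag_affine G) g).

Lemma point_ord (x : 'rV[k]_n) (i : 'I_n) : point x i = x ord0 i.
Proof. by rewrite /point valK. Qed.

(** * Regular functions and regular maps on the group *)

Definition regular (f : G -> k) := exists2 F, pfun n F & forall g, f g = F (gpoint g).

Lemma regular_const c : regular (fun=> c).
Proof. by exists (fun=> c) => //; apply: pfun_const. Qed.

Lemma regularD f1 f2 : regular f1 -> regular f2 -> regular (fun g => f1 g + f2 g).
Proof.
by move=> [F1 n1 e1] [F2 n2 e2]; exists (fun v => F1 v + F2 v) => [|g];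
  [apply: pfun_add|rewrite e1 e2].
Qed.

Lemma regularM f1 f2 : regular f1 -> regular f2 -> regular (fun g => f1 g * f2 g).
Proof.
by move=> [F1 n1 e1] [F2 n2 e2]; exists (fun v => F1 v * F2 v) => [|g];
  [apply: pfun_mul|rewrite e1 e2].
Qed.

Lemma meval_point (p : {mpoly k[n]}) (x : 'rV[k]_n) :
  p.@[x ord0] = p.@[fun i : 'I_n => point x i].
Proof. by apply: meval_eq => i; rewrite point_ord. Qed.

Lemma regular_mpoly (p : {mpoly k[n]}) :
  regular (fun g => p.@[aff_coord (aag_affine G) g ord0]).
Proof.
by exists (fun v => p.@[fun i : 'I_n => v i]) => [|g]; [apply: pfun_mpoly|apply: meval_point].
Qed.

Lemma regularV f : regular f -> regular (fun g => f g^-1%g).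
Proof.
move=> [F nF eF]; have [Q eQ] := aag_inv G.
pose H i (v : nat -> k) := if insub i is Some j then (Q ord0 j).@[fun i : 'I_n => v i] else 0.
exists (fun v => F (H ^~ v)) => [|g].
  apply: pfun_comp nF _ => i li; rewrite /H insubT.
  exact: pfun_mpoly.
rewrite eF; congr F; apply/funext => i; rewrite /gpoint /point /H.
by case: insubP => // j _ _; rewrite eQ mxE meval_point.
Qed.

Lemma regular_rep m (rho : G -> GL k m) i j : algGroup_hom rho ->
  regular (fun g => val (rho g) i j).
Proof.
move=> [_ [Q eQ]].
have [F nF eF] := regular_mpoly (Q ord0 (lshift 1 (mxvec_index i j))).
exists F => // g; rewrite -eF; have /rowP/(_ (lshift 1 (mxvec_index i j))) := eQ g.
by rewrite [RHS]mxE => <-; rewrite /= /gl_coord row_mxEl mxvecE.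
Qed.

Definition regular_map (H : G -> R) := exists m (f : nat -> G -> k) (e : nat -> R),
  (forall i, regular (f i)) /\ forall g, H g = \sum_(i < m) f i g *: e i.

Lemma regular_map0 : regular_map (fun=> 0).
Proof.
exists 0%N, (fun _ _ => 0), (fun=> 0); split=> [i|g]; first exact: regular_const.
by rewrite big_ord0.
Qed.

Lemma regular_map1 f r : regular f -> regular_map (fun g => f g *: r).
Proof.
by move=> rf; exists 1%N, (fun=> f), (fun=> r); split=> // g; rewrite big_ord1.
Qed.

Lemma regular_mapD H1 H2 : regular_map H1 -> regular_map H2 ->
  regular_map (fun g => H1 g + H2 g).
Proof.
move=> [m1 [f1 [e1 [r1 E1]]]] [m2 [f2 [e2 [r2 E2]]]].
exists (m1 + m2)%N, (fun i => if (i < m1)%N then f1 i else f2 (i - m1)%N),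
  (fun i => if (i < m1)%N then e1 i else e2 (i - m1)%N).
split=> [i|g]; first by case: ifP.
rewrite E1 E2 big_split_ord; congr (_ + _); apply: eq_bigr => i _ /=.
  by rewrite ltn_ord.
by rewrite ltnNge leq_addr /= addKn.
Qed.

Lemma regular_map_sum (T : Type) (s : seq T) (H : T -> G -> R) :
  (forall i, regular_map (H i)) -> regular_map (fun g => \sum_(i <- s) H i g).
Proof.
move=> rH; elim: s => [|x s IH].
  by under eq_fun do rewrite big_nil; apply: regular_map0.
by under eq_fun do rewrite big_cons; apply: regular_mapD.
Qed.

Lemma regular_mapZ f H : regular f -> regular_map H -> regular_map (fun g => f g *: H g).
Proof.
move=> rf [m [f1 [e [r1 E]]]]; exists m, (fun i g => f g * f1 i g), e.
split=> [i|g]; first exact: regularM.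
by rewrite E scaler_sumr; apply: eq_bigr => i _; rewrite scalerA.
Qed.

Lemma regular_act r : regular_map (fun g => a g r).
Proof.
have : setT r by []; rewrite -a_rational => -[V [m [e [rho [-> _ hrho eact]]]] [c ->]].
have -> : (fun g => a g (\sum_i c i *: e i)) =
    (fun g => \sum_j c j *: \sum_i val (rho g) i j *: e i).
  apply/funext => g; rewrite linear_sum; apply: eq_bigr => j _.
  by rewrite -eact linearZ.
apply: regular_map_sum => j; apply: (regular_mapZ (regular_const (c j))).
by apply: regular_map_sum => i; apply: regular_map1; apply: regular_rep.
Qed.

Lemma regular_mapV H : regular_map H -> regular_map (fun g => H g^-1%g).
Proof.
move=> [m [f [e [rf E]]]]; exists m, (fun i g => f i g^-1%g), e; split=> // i.
exact: regularV.
Qed.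

(** * Closed subsets of the group *)

Definition gclosed Y := exists2 S : set (G -> k), (forall f, S f -> regular f) &
  forall g, Y g <-> forall f, S f -> f g = 0.

Lemma gclosedI Y Z : gclosed Y -> gclosed Z -> gclosed (Y `&` Z).
Proof.
move=> [S rS eS] [T rT eT]; exists (S `|` T) => [f [/rS|/rT]//|g].
split=> [[/eS Sg /eT Tg] f [/Sg|/Tg]//|STg].
by split; [apply/eS|apply/eT] => f ?; apply: STg; [left|right].
Qed.

(** By induction on [m]: modulo [P], either the last [e m] is a combination of the earlier ones and
    is eliminated, or its coefficient must vanish. *)
Lemma gclosed_preimage (P : set R) H : two_sided_ideal P -> regular_map H ->
  gclosed [set g | P (H g)].
Proof.
move=> iP [m [f [e [rf E]]]].
have PZ (c : k) x : P x -> P (c *: x) by rewrite -mulr_algl; apply: idealMl.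
have -> : [set g | P (H g)] = [set g | P (\sum_(i < m) f i g *: e i)].
  by apply/funext => g; rewrite /= E.
elim: m f rf {E} => [|m IH] f rf.
  exists set0 => // g; split=> // _; rewrite /= big_ord0; exact: ideal0.
have [[c Pc]|nc] := pselect (exists c : nat -> k, P (e m - \sum_(i < m) c i *: e i)).
  have [|S rS eS] := IH (fun i g => f i g + f m g * c i).
    by move=> i; apply: regularD => //; apply: regularM => //; apply: regular_const.
  exists S => // g; rewrite -eS /= big_ord_recr /=.
  have Pd := PZ (f m g) _ Pc.
  rewrite -(idealBr _ iP Pd); apply: iff_sym; rewrite -propeqE; congr (P _).
  under eq_bigr do rewrite scalerDl -scalerA.
  by rewrite big_split /= -scaler_sumr scalerBr opprB -addrA [f m g *: e m + _]addrC subrK.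
have [S rS eS] := IH _ rf.
exists (S `|` [set f m]) => [h [/rS//|->//]|g]; rewrite /= big_ord_recr /=.
split=> [Pg|Sg]; last first.
  rewrite (Sg (f m)); last by right.
  by rewrite scale0r addr0; apply/eS => h Sh; apply: Sg; left.
have fm0 : f m g = 0.
  apply/eqP/negP => /negP fm0; apply: nc; exists (fun i => - ((f m g)^-1 * f i g)).
  have := PZ (f m g)^-1 _ Pg; rewrite scalerDr scalerA mulVf // scale1r addrC.
  suff -> : \sum_(i < m) - ((f m g)^-1 * f i g) *: e i =
    - ((f m g)^-1 *: \sum_(i < m) f i g *: e i) by rewrite opprK.
  by rewrite scaler_sumr -sumrN; apply: eq_bigr => i _; rewrite scaleNr scalerA.
move: Pg; rewrite fm0 scale0r addr0 => /eS Sg h [/Sg//|->].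
exact: fm0.
Qed.

(** A counterexample gives a strictly descending chain of closed sets; their vanishing ideals in the
    polynomial ring ascend and become stationary, which is absurd. *)
Lemma gclosed_ind (K : set G -> Prop) :
    (forall Y, gclosed Y -> (forall Z, gclosed Z -> Z `<=` Y -> Z <> Y -> K Z) -> K Y) ->
  forall Y, gclosed Y -> K Y.
Proof.
move=> Kind Y0 cY0; apply: contrapT => nY0.
pose T := {Y | gclosed Y /\ ~ K Y}.
have /choice[next nextP] : forall Y : T, exists Z : T,
    sval Z `<=` sval Y /\ sval Z <> sval Y.
  move=> [Y [cY nY]]; apply: contrapT => H; apply: (nY); apply: Kind => // Z cZ ZY neZ.
  by apply: contrapT => nZ; apply: H; exists (exist _ Z (conj cZ nZ)).
pose Y i := iter i next (exist _ Y0 (conj cY0 nY0) : T).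
have Yle i j : (i <= j)%N -> sval (Y j) `<=` sval (Y i).
  move=> /subnKC <-; elim: (j - i)%N => [|m IH]; first by rewrite addn0.
  by rewrite addnS => g /(nextP _).1 /IH.
pose ev g (F : ipoly n k) := ieval idfun (gpoint g) F.
pose I i : set (ipoly n k) := [set F | forall g, sval (Y i) g -> ev g F = 0].
have Ile i j : (i <= j)%N -> I i `<=` I j.
  by move=> /Yle Yij F IF g /Yij; apply: IF.
have lI i : left_ideal (I i).
  split=> [g _|x y Ix Iy g Yg|c x Ix g Yg]; rewrite /ev.
  - exact: ieval0.
  - by rewrite ievalB [ieval _ _ x]Ix // [ieval _ _ y]Iy // subrr.
  - rewrite ievalM => [|b z]; last exact: mulrC.
    by rewrite [ieval _ _ x]Ix // mulr0.
have lIU : left_ideal (\bigcup_i I i).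
  split=> [|x y [i _ Ix] [j _ Iy]|c x [i _ Ix]].
  - by exists 0%N => //; case: (lI 0%N).
  - exists (maxn i j) => //; case: (lI (maxn i j)) => _ + _; apply.
      exact: Ile (leq_maxl _ _) _ Ix.
    exact: Ile (leq_maxr _ _) _ Iy.
  - by exists i => //; case: (lI i) => _ _; apply.
have [s sI sgen] := left_noetherian_ipoly (n := n) (@left_noetherian_field k) lIU.
have [M sM] : exists M, {in s, forall F, I M F}.
  elim: s sI {sgen} => [|F s IH] sI; first by exists 0%N.
  have [|M sM] := IH; first by move=> x xs; apply: sI; rewrite inE xs orbT.
  have [i _ Fi] := sI F (mem_head _ _).
  exists (maxn i M) => H; rewrite inE => /predU1P[->|/sM].
    exact: Ile (leq_maxl _ _) _ Fi.
  exact: Ile (leq_maxr _ _) _.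
have IM := sgen _ (lI M) sM.
have [le ne] := nextP (Y M); apply: ne; apply/seteqP; split=> // g Yg.
have [[S rS eS] _] := svalP (next (Y M)).
apply/eS => f Sf; have [F nF eF] := rS f Sf.
have [H eH] := ipoly_of_pfun (phi := idfun) (@mulrC k) nF.
have IH : I M.+1 H by move=> h /eS Yh; rewrite /ev eH /= -eF; apply: Yh.
have /(_ g Yg) : I M H by apply: IM; exists M.+1.
by rewrite /ev eH /= -eF.
Qed.

(** * Ideals attached to pieces of the orbit *)

Variable P : Spec R.

(** The value of [F] at [g] lies in [g.P] exactly when [geval g F] lies in [P]: the moving prime is
    replaced by a fixed one. *)
Definition geval g (F : ipoly n R) : R :=
  a g^-1%g (ieval (in_alg R) (gpoint g) F).

Lemma in_algC (c : k) (x : R) : in_alg R c * x = x * in_alg R c.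
Proof. by rewrite /= mulr_algl mulr_algr. Qed.

Lemma gevalB g F H : geval g (F - H) = geval g F - geval g H.
Proof. by rewrite /geval ievalB raddfB. Qed.

Lemma gevalM g F H : geval g (F * H) = geval g F * geval g H.
Proof. by rewrite /geval ievalM ?rmorphM //; apply: in_algC. Qed.

Lemma geval0 g : geval g 0 = 0.
Proof. by rewrite /geval ieval0 raddf0. Qed.

Lemma geval1 g : geval g 1 = 1.
Proof. by rewrite /geval ieval1 rmorph1. Qed.

Lemma gevalC g r : geval g (ipolyC n r) = a g^-1%g r.
Proof. by rewrite /geval ieval_ipolyC. Qed.

Lemma regular_geval F : regular_map (fun g => geval g F).
Proof.
have := pmap_ipoly F in_algC; rewrite /geval.
have : forall H : (nat -> k) -> R, pmap n (in_alg R) H ->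
    regular_map (fun g => a g^-1%g (H (gpoint g))); last by move=> + H => /(_ _ H).
move=> H; elim=> [|f r nf|H1 H2 _ r1 _ r2].
- by under eq_fun do rewrite raddf0; apply: regular_map0.
- under eq_fun do rewrite /= mulr_algl linearZ.
  apply: regular_mapZ; first by exists f.
  exact/(regular_mapV (regular_act r)).
- by under eq_fun do rewrite raddfD; apply: regular_mapD.
Qed.

(** For this [F], [geval g F] is [r] at every [g]; so elements of [P] lift into every orbit
    ideal. *)
Lemma ipoly_act r : exists F : ipoly n R, forall g, ieval (in_alg R) (gpoint g) F = a g r.
Proof.
have [m [f [e [rf E]]]] := regular_act r.
have /choice[F FP] : forall i, exists F : ipoly n R, forall g,
    ieval (in_alg R) (gpoint g) F = f i g *: e i.
  move=> i; have [H nH eH] := rf i; have [F eF] := ipoly_of_pfun in_algC nH.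
  exists (F * ipolyC n (e i)) => g.
  by rewrite ievalM ?eF ?ieval_ipolyC /= -?eH ?mulr_algl //; apply: in_algC.
exists (\sum_(i < m) F i) => g; rewrite E.
elim: m {E} => [|m IH]; first by rewrite !big_ord0 ieval0.
by rewrite !big_ord_recr ievalD IH FP.
Qed.

Definition orbit_ideal Y : set (ipoly n R) := [set F | forall g, Y g -> spec_set P (geval g F)].

Lemma orbit_ideal_ideal Y : two_sided_ideal (orbit_ideal Y).
Proof.
have iP := spec_ideal P; split=> [g _|F H PF PH g Yg|H F PF g Yg|H F PF g Yg].
- by rewrite geval0; apply: ideal0.
- by rewrite gevalB; apply: (idealB iP); [apply: PF|apply: PH].
- by rewrite gevalM; apply: (idealMl iP); apply: PF.
- by rewrite gevalM; apply: (idealMr iP); apply: PF.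
Qed.

Inductive prime_union : set G -> Prop :=
| prime_union0 : prime_union set0
| prime_unionU Y Z : prime_elt (orbit_ideal Y) -> prime_union Z -> prime_union (Y `|` Z).

Lemma prime_union_cat Y Z : prime_union Y -> prime_union Z -> prime_union (Y `|` Z).
Proof.
move=> uY uZ; elim: uY => [|Y1 Y2 pY _ IH]; first by rewrite set0U.
by rewrite -setUA; apply: prime_unionU.
Qed.

(** If [F] and [H] witness that the orbit ideal is not prime, the conditions that [geval g F] or
    [geval g H] lie in [P] cut out proper closed subsets of [Y], which cover [Y] because [P] is
    prime. *)
Lemma gclosed_prime_union Y : gclosed Y -> prime_union Y.
Proof.
elim/gclosed_ind => {}Y cY IH; have iP := spec_ideal P.
have [P1|P1] := pselect (orbit_ideal Y 1).
  suff -> : Y = set0 by apply: prime_union0.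
  apply/seteqP; split=> // g Yg; have := P1 g Yg; rewrite geval1.
  exact: spec_not1.
have [pY|nY] := pselect (prime_elt (orbit_ideal Y)).
  by rewrite -(setU0 Y); apply: prime_unionU => //; apply: prime_union0.
have [F [H [FH [nF nH]]]] : exists F H, (forall s, orbit_ideal Y (F * s * H)) /\
    ~ orbit_ideal Y F /\ ~ orbit_ideal Y H.
  apply: contrapT => nFH; apply: nY; split=> //; first exact: orbit_ideal_ideal.
  move=> F H FH; apply: contrapT => /not_orP nor; apply: nFH; exists F, H.
  by split.
pose Z (E : ipoly n R) := Y `&` [set g | spec_set P (geval g E)].
have cZ E : ~ orbit_ideal Y E -> prime_union (Z E).
  move=> nE; apply: IH; last 1 first.
  - by move=> eZ; apply: nE => g; rewrite -eZ => -[].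
  - by apply: gclosedI => //; apply: gclosed_preimage => //; apply: regular_geval.
  - by move=> g [].
suff -> : Y = Z F `|` Z H by apply: prime_union_cat; apply: cZ.
apply/seteqP; split=> [g Yg|g [[]|[]]//].
have [_ _ PM] := prime_ideal_elt (specP P).
suff [PF|PH] : spec_set P (geval g F) \/ spec_set P (geval g H) by [left|right].
(* The constant [a g s] is the one that [geval g] sends to [s]. *)
apply: PM => s; have := FH (ipolyC n (a g s)) g Yg.
by rewrite !gevalM gevalC actK.
Qed.

Definition core Y : set R := [set r | forall g, Y g -> spec_set P (a g^-1%g r)].

Lemma core_orbit_ideal Y : core Y = icontraction (orbit_ideal Y).
Proof.
apply/seteqP; split=> r Pr g Yg; first by rewrite gevalC; apply: Pr.
by rewrite -gevalC; apply: Pr.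
Qed.

Lemma point_exists (v : nat -> k) :
    (forall f, pfun n f -> (forall g, f (gpoint g) = 0) -> f v = 0) ->
  exists g, forall i, (i < n)%N -> v i = gpoint g i.
Proof.
move=> v0; pose x : 'rV[k]_n := \row_i v i.
have vx i : (i < n)%N -> v i = point x i.
  by move=> li; rewrite -[i]/(nat_of_ord (Ordinal li)) point_ord mxE.
have [S eS] := aff_closed (aag_affine G).
suff : zero_locus S x by rewrite -eS => -[g _ ex]; exists g => i /vx; rewrite -ex.
move=> p Sp; rewrite (meval_eq (v2 := fun i : 'I_n => v i)) => [|i]; last by rewrite mxE.
apply: (v0 (fun v => p.@[fun i : 'I_n => v i])) => [|g]; first exact: pfun_mpoly.
rewrite -meval_point; have : range (aff_coord (aag_affine G)) (aff_coord (aag_affine G) g).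
  by exists g.
by rewrite eS; apply.
Qed.

(** * Local closedness and the rational primes above the core *)

Hypothesis P_locally_closed : locally_closed_point P.

(** A prime containing [P] lies in the closure of [P], and [I] defines an open set meeting this
    closure in [P] alone. *)
Lemma locally_closed_ideal : exists I : set R, [/\ two_sided_ideal I, ~ I `<=` P &
  forall Q : Spec R, (P : set R) `<=` Q -> ~ I `<=` Q -> Q = P].
Proof.
have /open_in_closureP[_ [I ->] eP] := P_locally_closed.
have nIP : ~ VSpec I P by have : [set P] P by []; rewrite eP => -[].
exists (ideal_gen I); split=> [||Q PQ nIQ]; first exact: ideal_gen_ideal.
  by move=> IP; apply: nIP; apply: subset_trans IP; apply: sub_ideal_gen.
suff : [set P] Q by [].
rewrite eP; split.
  by move=> IQ; apply: nIQ; apply: ideal_gen_sub => //; apply: spec_ideal.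
rewrite closureE => B [/zariski_closedP[J eJ] PB].
by rewrite eJ; apply: subset_trans PQ; have : B P by [apply: PB]; rewrite eJ.
Qed.

Lemma generic_orbit Y : prime_elt (orbit_ideal Y) ->
  exists B, [/\ two_sided_ideal B, ~ B `<=` core Y &
    forall Q : Spec R, RatSpec R Q -> core Y `<=` Q -> ~ B `<=` Q ->
      exists g, Q = spec_act a g P].
Proof.
move=> pY; have [I [iI nIP Pmax]] := locally_closed_ideal.
pose D : set (ipoly n R) := [set F | forall g, I (geval g F)].
have iD : two_sided_ideal D.
  split=> [g|F H DF DH g|H F DF g|H F DF g].
  - by rewrite geval0; apply: ideal0.
  - by rewrite gevalB; apply: idealB.
  - by rewrite gevalM; apply: idealMl.
  - by rewrite gevalM; apply: idealMr.
have gact r : exists F : ipoly n R, forall g, geval g F = r.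
  by have [F eF] := ipoly_act r; exists F => g; rewrite /geval eF actK.
have DY : ~ D `<=` orbit_ideal Y.
  (* As 1 is not in the orbit ideal, [Y] has a point [g]; lifting the elements of [I] would put [I]
     inside [P]. *)
  move=> DY; have [_ nY1 _] := pY; apply: nY1 => g Yg; exfalso; apply: nIP => r Ir.
  by have [F eF] := gact r; rewrite -(eF g); apply: DY => // h; rewrite eF.
have [B [iB BY HB]] := generic_ipoint in_algC pY iD DY.
exists B; rewrite core_orbit_ideal; split=> // Q rQ YQ BQ.
have pQ := prime_ideal_elt (specP Q).
have [v [Yv Dv]] := HB Q pQ (rational_Rat rQ) YQ BQ.
(* A function vanishing on the group lifts into the orbit ideal, so its value at [v] is a scalar in
   [Q], hence 0. *)
have [g vg] : exists g, forall i, (i < n)%N -> v i = gpoint g i.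
  apply: point_exists => f nf f0; have [F eF] := ipoly_of_pfun in_algC nf.
  have : spec_set Q (ieval (in_alg R) v F).
    by apply: Yv => h _; rewrite /geval eF f0 rmorph0 raddf0; apply: ideal0 (spec_ideal P).
  rewrite eF => Qf; apply/eqP/negP => /negP fv.
  apply: (@spec_not1 _ Q); have := idealMl (spec_ideal Q) (in_alg R (f v)^-1) Qf.
  by rewrite -rmorphM mulVf // rmorph1.
exists g; have vE F : ieval (in_alg R) v F = a g (geval g F).
  by rewrite /geval actVK; apply: ieval_ext.
have PQ : (P : set R) `<=` spec_act a g^-1%g Q.
  move=> r Pr; apply/spec_actE; rewrite invgK; have [F eF] := gact r.
  by have := Yv F; rewrite vE !eF; apply=> h _; rewrite eF.
have IQ : ~ I `<=` spec_act a g^-1%g Q.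
  move=> IQ; apply: Dv => F DF; rewrite vE -[g in a g _]invgK.
  by apply/spec_actE; apply: IQ; apply: DF.
by rewrite -(Pmax _ PQ IQ) spec_actM mulgV spec_act1.
Qed.

(** If [core Z] is inside [core Y], adding [Y] does not change the core. Otherwise [core Z] is
    intersected with [B]: a prime [Q] above both cores' intersection but not above [core Z] contains
    [core Y]. *)
Lemma prime_union_orbit Y : prime_union Y -> Y = set0 \/
  exists B, [/\ two_sided_ideal B, ~ B `<=` core Y &
    forall Q : Spec R, RatSpec R Q -> core Y `<=` Q -> ~ B `<=` Q ->
      exists g, Q = spec_act a g P].
Proof.
elim=> [|{}Y Z pY _ IH]; first by left.
right; have [B [iB BY HB]] := generic_orbit pY.
have coreU : core (Y `|` Z) = core Y `&` core Z.
  apply/seteqP; split=> [r Pr|r [PY PZ] g [/PY|/PZ]//].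
  by split=> g ?; apply: Pr; [left|right].
have pcY : prime_elt (core Y) by rewrite core_orbit_ideal; apply: icontraction_prime.
have icZ : two_sided_ideal (core Z).
  by rewrite core_orbit_ideal; apply/icontraction_ideal/orbit_ideal_ideal.
have [icY nY1 _] := pcY.
have [ZY|nZY] := pselect (core Z `<=` core Y).
  case: IH => [Z0|]; first by exfalso; apply: nY1; apply: ZY; rewrite Z0.
  by rewrite coreU (_ : core Y `&` core Z = core Z) //; apply/setIidr.
exists (core Z `&` B); split; first exact: idealI.
  by rewrite coreU => H; apply: (prime_eltI pcY icZ iB nZY BY) => x /H[].
move=> Q rQ; rewrite coreU => YZQ nQ; have pQ := prime_ideal_elt (specP Q).
have nZQ : ~ core Z `<=` Q by move=> H; apply: nQ => x [/H].
apply: HB => //; last by move=> H; apply: nQ => x [_ /H].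
apply: contrapT => nYQ; apply: (prime_elt_sub pQ icY nYQ nZQ) => x y Yx Zy.
by apply: YZQ; split; [apply: (idealMr icY)|apply: (idealMl icZ)].
Qed.

Lemma generic_orbitT : exists B : set R, ~ B `<=` core setT /\
  forall Q : Spec R, RatSpec R Q -> core setT `<=` Q -> ~ B `<=` Q ->
    exists g, Q = spec_act a g P.
Proof.
have cT : gclosed setT.
  by exists set0.
have [/seteqP[/(_ 1%g) H _]|[B [_ BT HB]]] := prime_union_orbit (gclosed_prime_union cT).
  by exfalso; apply: H.
by exists B.
Qed.
End Orbit.

Theorem corollary2 (k : closedFieldType) (G : affineAlgGroup k) (R : algType k)
    (a : algAction G R) (a_rational : rational_action a)
    (P : RatSpec R) (P_locally_closed : locally_closed_point (val P : Spec R)) :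
  open_in_closure (rat_orbit a P).
Proof.
have [B [nB HB]] := generic_orbitT a_rational P_locally_closed.
set N := core a (val P) setT in nB HB.
pose hB : set R := [set r | exists h x, B x /\ r = a h x].
have valE (Q1 Q2 : RatSpec R) : val Q1 = val Q2 -> Q1 = Q2 by apply: val_inj.
apply/open_in_closureP; exists [set Q : RatSpec R | ~ hB `<=` spec_set (val Q)].
  by exists (~` VSpec hB) => //; exists hB.
apply/seteqP; split=> [_ [g _ <-]|Q [nhB]].
  split; last by apply: subset_closure; exists g.
  (* Some [r] in [B] is outside [g0.P]; translation by [g * g0^-1] moves it outside [g.P]. *)
  move: nB => /existsNP[r /not_implyP[Br /existsNP[g0 /not_implyP[_ nr]]]] /= hBP.
  have /spec_actE : spec_set (spec_act a g (val P)) (a (g * g0^-1)%g r).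
    by apply: hBP; exists (g * g0^-1)%g, r.
  by rewrite -actM mulgA mulVg mul1g.
rewrite closureE => clQ; have NQ : N `<=` spec_set (val Q).
  apply: (clQ [set Q : RatSpec R | N `<=` spec_set (val Q)]); split.
    by rewrite -openC; exists (~` VSpec N) => //; exists N.
  by move=> _ [g _ <-] r Nr; apply/spec_actE; apply: Nr.
(* Some translate of [B] is not inside [Q]. Moving [Q] back by [h] makes [HB] applicable, since [N],
   the intersection of the whole orbit, is stable. *)
have [h hBQ] : exists h, ~ B `<=` spec_set (spec_act a h^-1%g (val Q)).
  apply/existsNP => H; apply: nhB => _ [h [x [Bx ->]]].
  by have /spec_actE := H h x Bx; rewrite invgK.
have [||//|g eg] := HB (spec_act a h^-1%g (val Q)).
- by apply: Rat_stable; apply: set_mem; apply: valP.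
- move=> r Nr; apply/spec_actE; rewrite invgK; apply: NQ => g _.
  rewrite -actM; have := Nr (h^-1 * g)%g Logic.I.
  by rewrite invgM invgK.
exists (h * g)%g => //; apply: valE.
by rewrite /= -spec_actM -eg spec_actM mulgV spec_act1.
Qed.
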